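(* Assume $\frac{22\pi-8}{15\pi}B^2< C<\frac{22}{15}B^2$, and assume $C\neq H(m)B^2$ for all integers $m\ge0$. Define $$n:=\max\Big\{m\in\mathbb Z_{\ge0}:\ C>\tfrac{22(4m+1)\pi-8}{15(4m+1)\pi}B^2\Big\},$$ and let $k$ be an integer with $0\le k\le n$. Then the $k$th Hopf bifurcation is subcritical, and for all sufficiently small $\eta>0$ the following hold. If $k<n$, then $$\frac{4+\frac{2\eta}{(n-k+1)\pi}}{4k+1-\frac{2\eta}{\pi}}<T^k_\eta<\frac{4+\frac{2\eta}{(n-k)\pi}}{4k+1-\frac{2\eta}{\pi}}.$$ If $k=n$, then $$T^k_\eta>\frac{4+\frac{2\eta}{\pi}}{4k+1-\frac{2\eta}{\pi}}.$$
   Context: Consider the scalar delay differential equation (1) $x'(t)=-\mu f(x(t-1))$, with real parameter $\mu$ and phase space $C([-1,0],\mathbb R)$. Here $f:\mathbb R\to\mathbb R$ is $C^3$ with $f(0)=0$ and $f'(0)=1$, so that $f(\xi)=\xi+B\xi^2+C\xi^3+o(\xi^3)$ with $B=f''(0)/2$ and $C=f'''(0)/6$. For $k\in\mathbb Z$ let $\mu_k=\frac{(4k+1)\pi}{2}$ and $H(k)=\frac{22(4k+1)\pi-8}{15(4k+1)\pi}$. The $k$th Hopf bifurcation (at $\mu_k$) is supercritical if $C<H(k)B^2$ and subcritical if $C>H(k)B^2$; it is called nondegenerate if $C\ne H(k)B^2$. Supercritical means the bifurcating small periodic orbits are stable within the center manifold; subcritical means they are unstable there. Hopf branch notation, for $k\ge0$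 with a nondegenerate $k$th bifurcation: put $\delta_k=1$ if it is supercritical and $\delta_k=-1$ if it is subcritical. There are $\eta_k>0$ and a family of nonconstant periodic solutions $p^k_\eta$, $\eta\in(0,\eta_k)$, of (1) with parameter $\mu=\mu_k+\delta_k\eta$. These bifurcate from $0$ at $\mu_k$ (amplitude $\to0$ as $\eta\to0$), and they are locally unique up to time translation. $T^k_\eta$ denotes the minimal period of $p^k_\eta$, and $T^k_\eta\to T^k_0:=\frac{4}{4k+1}$ as $\eta\to0$. *)

(* Defs.v *)
From Stdlib Require Import Reals Lra.
Open Scope R_scope.

Definition is_C3 (f f1 f2 f3 : R -> R) : Prop :=
  (forall x, derivable_pt_lim f x (f1 x)) /\
  (forall x, derivable_pt_lim f1 x (f2 x)) /\
  (forall x, derivable_pt_lim f2 x (f3 x)) /\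
  continuity f3.

Definition Hk (k : nat) : R :=
  (22 * (4 * INR k + 1) * PI - 8) / (15 * (4 * INR k + 1) * PI).

Definition mu_k (k : nat) : R := (4 * INR k + 1) * PI / 2.

Definition is_solution (mu : R) (f : R -> R) (x : R -> R) : Prop :=
  forall t, derivable_pt_lim x t (- mu * f (x (t - 1))).

Definition minimal_period (x : R -> R) (T : R) : Prop :=
  0 < T /\ (forall t, x (t + T) = x t) /\
  (forall s, 0 < s < T -> ~ (forall t, x (t + s) = x t)).

Definition nonconstant (x : R -> R) : Prop := exists t1 t2, x t1 <> x t2.

(* sign of the k-th Hopf branch: 1 if supercritical, -1 if subcritical *)
Definition delta_k (B C : R) (k : nat) : R :=
  if Rlt_dec C (Hk k * B ^ 2) then 1 else -1.

Definition hopf_branch (f : R -> R) (B C : R) (k : nat)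
    (etak : R) (p : R -> R -> R) (T : R -> R) : Prop :=
  0 < etak /\
  (forall eta, 0 < eta < etak ->
     is_solution (mu_k k + delta_k B C k * eta) f (p eta) /\
     nonconstant (p eta) /\ minimal_period (p eta) (T eta)) /\
  (forall eps, 0 < eps -> exists d, 0 < d /\
     forall eta, 0 < eta < etak -> eta < d -> forall t, Rabs (p eta t) < eps) /\
  (forall eps, 0 < eps -> exists d, 0 < d /\
     forall eta, 0 < eta < etak -> eta < d ->
       Rabs (T eta - 4 / (4 * INR k + 1)) < eps).

(* Main.v *)
Require Import Defs.
From Stdlib Require Import Reals Lra Lia Psatz.
From Coquelicot Require Import Coquelicot.
Open Scope R_scope.

(* Put [w = 2 PI / T], [lam = w / mu], [w0 = mu_k k]. The rescaled solution [u] is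
   [2 PI]-periodic with [lam * u' (s + w) = - f (u s)]. After a translation its first Fourier
   mode is [A cos s]. Its mean is fixed by the vanishing of the mean of [f (u s)], and a
   periodic function [z] without mean and first mode satisfies [sup |z| <= c sup |z'|] with
   [c < 1], so the linear part of the equation determines the remaining modes:
   [u = A cos s + A^2 V s + o(A^2)] uniformly, with [V] an explicit trigonometric polynomial.
   Projecting the equation on [cos] and [sin] then gives
     [lam sin w = 1 + (3/4 C - 11/10 B^2) A^2 + o(A^2)],  [lam cos w = B^2/5 A^2 + o(A^2)].
   To first order in [A^2] this determines both [eta = w0 - mu] and [w - w0]; the period
   exceeds the bound with parameter [j] exactly when
   [(11/10 B^2 - 3/4 C) * mu_k (k + j) > B^2 / 5], that is [C < Hk (k + j) * B^2]. *)

(** * Integrals over one period *)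

Definition pint (h : R -> R) : R := RInt h 0 (2 * PI).

Lemma ex_RInt_continuity (h : R -> R) (a b : R) : continuity h -> ex_RInt h a b.
Proof.
intros Hh. apply (ex_RInt_continuous (V := R_CompleteNormedModule)).
intros z _. apply continuity_pt_filterlim. apply Hh.
Qed.

Lemma continuity_add (f g : R -> R) :
  continuity f -> continuity g -> continuity (fun s => f s + g s).
Proof. exact (continuity_plus f g). Qed.

Lemma continuity_mul (f g : R -> R) :
  continuity f -> continuity g -> continuity (fun s => f s * g s).
Proof. exact (continuity_mult f g). Qed.

Lemma continuity_sub (f g : R -> R) :
  continuity f -> continuity g -> continuity (fun s => f s - g s).
Proof. exact (continuity_minus f g). Qed.

Lemma continuity_cst (c : R) : continuity (fun _ => c).
Proof. apply continuity_const. intros x y. reflexivity. Qed.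

Lemma continuity_translate (f : R -> R) (a : R) :
  continuity f -> continuity (fun s => f (s + a)).
Proof.
intros Hf. apply (continuity_comp (fun s => s + a) f); [| exact Hf].
apply continuity_add; [exact (derivable_continuous _ derivable_id) | apply continuity_cst].
Qed.

Lemma continuity_derive (f : R -> R) (f' : R -> R) :
  (forall s, is_derive f s (f' s)) -> continuity f.
Proof.
intros Hf s. apply continuity_pt_filterlim.
apply (ex_derive_continuous (V := R_NormedModule)). exists (f' s). apply Hf.
Qed.

Ltac eqR := match goal with |- @eq _ ?a ?b => change (@eq R a b) end.

Lemma continuity_idR : continuity (fun s => s).
Proof. exact (derivable_continuous _ derivable_id). Qed.

Ltac cont := repeat first
  [ assumption
  | exact continuity_sin | exact continuity_cos | exact continuity_idR
  | apply continuity_cst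
  | match goal with
    | |- continuity (fun s => @?f s - @?g s) => apply (continuity_sub f g)
    | |- continuity (fun s => @?f s + @?g s) => apply (continuity_add f g)
    | |- continuity (fun s => @?f s * @?g s) => apply (continuity_mul f g)
    | |- continuity (fun s => ?f (s + _)) => apply (continuity_translate f)
    end ].

Lemma pint_ext (f g : R -> R) : (forall s, f s = g s) -> pint f = pint g.
Proof. intros H. apply RInt_ext. intros x _. apply H. Qed.

Lemma pint_add (f g : R -> R) : continuity f -> continuity g ->
  pint (fun s => f s + g s) = pint f + pint g.
Proof.
intros Hf Hg. apply (RInt_plus (V := R_CompleteNormedModule)); now apply ex_RInt_continuity.
Qed.

Lemma pint_scal (c : R) (f : R -> R) : continuity f ->
  pint (fun s => c * f s) = c * pint f.
Proof.
intros Hf. apply (RInt_scal (V := R_CompleteNormedModule)); now apply ex_RInt_continuity.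
Qed.

Lemma pint_sub (f g : R -> R) : continuity f -> continuity g ->
  pint (fun s => f s - g s) = pint f - pint g.
Proof.
intros Hf Hg. apply (RInt_minus (V := R_CompleteNormedModule)); now apply ex_RInt_continuity.
Qed.

Lemma RInt_derivative (F h : R -> R) (a b : R) :
  (forall s, is_derive F s (h s)) -> continuity h -> RInt h a b = F b - F a.
Proof.
intros HF Hh. apply is_RInt_unique. apply (is_RInt_derive F h).
- intros x _. apply HF.
- intros x _. apply continuity_pt_filterlim. apply Hh.
Qed.

Lemma pint_bound (f : R -> R) (M : R) : continuity f ->
  (forall s, Rabs (f s) <= M) -> Rabs (pint f) <= 2 * PI * M.
Proof.
intros Hf HM. assert (HP := PI_RGT_0).
replace (2 * PI * M) with ((2 * PI - 0) * M) by ring.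
apply abs_RInt_le_const; [lra | now apply ex_RInt_continuity | intros; apply HM].
Qed.

Lemma RInt_translate (h : R -> R) (a b c : R) : continuity h ->
  RInt (fun s => h (s + c)) a b = RInt h (a + c) (b + c).
Proof.
intros Hh.
assert (H := RInt_comp_lin h 1 c a b).
rewrite !Rmult_1_l in H. rewrite <- H by (now apply ex_RInt_continuity).
apply RInt_ext. intros x _. change scal with Rmult. cbn. rewrite !Rmult_1_l. reflexivity.
Qed.

(** Splitting the integral over [[0, 2 * PI + a]] once at [a] and once at [2 * PI] leaves two end
    pieces, over [[0, a]] and [[2 * PI, 2 * PI + a]], which agree by periodicity. *)
Lemma pint_translate (h : R -> R) (a : R) : continuity h ->
  (forall s, h (s + 2 * PI) = h s) -> pint (fun s => h (s + a)) = pint h.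
Proof.
intros Hh Hp. unfold pint. rewrite RInt_translate by assumption.
assert (E : RInt h (2 * PI) (2 * PI + a) = RInt h 0 a).
{ replace (2 * PI) with (0 + 2 * PI) at 1 by ring.
  rewrite (Rplus_comm (2 * PI) a).
  rewrite <- (RInt_translate h 0 a (2 * PI) Hh). apply RInt_ext. intros; apply Hp. }
assert (C1 := RInt_Chasles h 0 (0 + a) (2 * PI + a)
  (ex_RInt_continuity h _ _ Hh) (ex_RInt_continuity h _ _ Hh)).
assert (C2 := RInt_Chasles h 0 (2 * PI) (2 * PI + a)
  (ex_RInt_continuity h _ _ Hh) (ex_RInt_continuity h _ _ Hh)).
rewrite <- C2 in C1. rewrite E, Rplus_0_l in C1. rewrite Rplus_0_l.
change (RInt h 0 a + RInt h a (2 * PI + a) = RInt h 0 (2 * PI) + RInt h 0 a) in C1.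
exact (Rplus_eq_reg_l _ _ _ (eq_trans C1 (Rplus_comm _ _))).
Qed.

(** * A sup bound for periodic functions without first Fourier mode *)

(** If [PI] were at least [16 / 5], then [cos (8 / 5)] would be nonnegative; the quartic Taylor
    polynomial, an upper bound of the cosine, is already negative at [8 / 5]. *)
Lemma PI_lt_16_5 : PI < 16 / 5.
Proof.
destruct (Rlt_or_le PI (16 / 5)) as [H | H]; [exact H | exfalso].
assert (H4 := PI_4).
assert (Hc : 0 <= cos (8 / 5)) by (apply cos_ge_0; lra).
destruct (pre_cos_bound (8 / 5) 0) as [_ Hb]; try lra.
unfold cos_approx, cos_term in Hb. simpl in Hb. lra.
Qed.

Lemma sin_cos_sq (s : R) : sin s * sin s + cos s * cos s = 1.
Proof. exact (sin2_cos2 s). Qed.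

Lemma sin_le_id (x : R) : 0 <= x -> sin x <= x.
Proof.
intros [H | H]; [now apply Rlt_le, sin_lt_x | subst; rewrite sin_0; lra].
Qed.

(* Kernel [G s = PI - s - sin s]: integrating [G h] by parts reproduces [z], and
   [G] has constant sign on each half period, with [int |G| = PI^2 - 4 < 2 PI]. *)
Lemma high_mode_bound (z h : R -> R) (H m : R) :
  (forall s, is_derive z s (h s)) -> continuity h ->
  (forall s, z (s + 2 * PI) = z s) ->
  (forall s, Rabs (h s) <= H) ->
  Rabs (pint z) <= 2 * PI * m ->
  pint (fun s => z s * cos s) = 0 -> pint (fun s => z s * sin s) = 0 ->
  forall t, Rabs (z t) <= m + 39 / 40 * H.
Proof.
intros Hz Hh Hp HH Hm Hc Hs t.
assert (Cz : continuity z) by (eapply continuity_derive; eauto).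
assert (HP := PI_RGT_0). assert (HP2 := PI_lt_16_5).
assert (H0 : 0 <= H) by (eapply Rle_trans; [apply Rabs_pos | apply (HH 0)]).
set (G := fun s => PI - s - sin s).
assert (CG : continuity G) by (unfold G; cont).
assert (Cht : continuity (fun s => h (s + t))) by cont.
(* Translating by [t] moves the evaluation point to both ends of the period, where [G] equals [PI]
   and [- PI]; the boundary terms add up to [- (2 * PI) * z t]. *)
assert (P : pint (fun s => G s * h (s + t) - (1 + cos s) * z (s + t)) = - (2 * PI) * z t).
{ unfold pint. rewrite (RInt_derivative (fun s => G s * z (s + t))).
  - unfold G. rewrite sin_0, sin_2PI.
    rewrite (Rplus_comm (2 * PI) t), Hp, Rplus_0_l. ring.
  - intros s. unfold G.
    evar_last.
    { apply (is_derive_mult (fun s => PI - s - sin s) (fun s => z (s + t))).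
      - auto_derive; [exact I | reflexivity].
      - apply (is_derive_comp z (fun s => s + t)); [apply Hz |].
        auto_derive; [exact I | reflexivity].
      - intros; apply Rmult_comm. }
    change plus with Rplus; change mult with Rmult; change scal with Rmult. cbn. ring.
  - cont. }
rewrite pint_sub in P by cont.
(* After expanding [cos (r - t)], the vanishing first mode removes the cosine weight and only the
   mean of [z] remains. *)
assert (Q : pint (fun s => (1 + cos s) * z (s + t)) = pint z).
{ transitivity (pint (fun r => (1 + cos (r - t)) * z r)).
  - rewrite <- (pint_translate (fun r => (1 + cos (r - t)) * z r) t).
    + apply pint_ext; intros s. do 3 f_equal. ring.
    + apply continuity_mul; [| exact Cz].
      apply continuity_add; [cont |]. apply (continuity_translate cos (- t)). cont.
    + intros s. rewrite Hp. f_equal. f_equal.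
      replace (s + 2 * PI - t) with (s - t + 2 * PI) by ring.
      rewrite cos_plus, cos_2PI, sin_2PI. ring.
  - transitivity (pint (fun s => z s + (cos t * (z s * cos s) + sin t * (z s * sin s)))).
    + apply pint_ext; intros s. rewrite cos_minus. ring.
    + rewrite pint_add, pint_add, !pint_scal, Hc, Hs by cont. ring. }
assert (B1 : Rabs (RInt (fun s => G s * h (s + t)) 0 PI) <= H * (PI * PI / 2 - 2)).
{ replace (H * (PI * PI / 2 - 2)) with (RInt (fun s => H * G s) 0 PI).
  - apply Rle_trans with (RInt (fun s => Rabs (G s * h (s + t))) 0 PI).
    + apply abs_RInt_le; [lra | apply ex_RInt_continuity; cont].
    + apply RInt_le; [lra | | apply ex_RInt_continuity; cont |].
      * apply ex_RInt_continuity. apply (continuity_comp _ Rabs); [cont | exact Rcontinuity_abs].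
      * intros s Hs0. rewrite Rabs_mult.
        assert (0 <= G s).
        { unfold G. rewrite <- sin_PI_x.
          assert (sin (PI - s) <= PI - s) by (apply sin_le_id; lra). lra. }
        rewrite (Rabs_pos_eq (G s)) by assumption.
        rewrite Rmult_comm. apply Rmult_le_compat_r; [assumption | apply HH].
  - rewrite (RInt_derivative (fun s => H * (PI * s - s * s / 2 + cos s))).
    + rewrite cos_PI, cos_0. eqR; field.
    + intros s. unfold G. auto_derive; [exact I | eqR; field].
    + cont. }
assert (B2 : Rabs (RInt (fun s => G s * h (s + t)) PI (2 * PI)) <= H * (PI * PI / 2 - 2)).
{ replace (H * (PI * PI / 2 - 2)) with (RInt (fun s => - H * G s) PI (2 * PI)).
  - apply Rle_trans with (RInt (fun s => Rabs (G s * h (s + t))) PI (2 * PI)).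
    + apply abs_RInt_le; [lra | apply ex_RInt_continuity; cont].
    + apply RInt_le; [lra | | apply ex_RInt_continuity; cont |].
      * apply ex_RInt_continuity. apply (continuity_comp _ Rabs); [cont | exact Rcontinuity_abs].
      * intros s Hs0. rewrite Rabs_mult.
        assert (G s <= 0).
        { unfold G. replace (sin s) with (- sin (s - PI)).
          - assert (sin (s - PI) <= s - PI) by (apply sin_le_id; lra). lra.
          - rewrite sin_minus, cos_PI, sin_PI. ring. }
        rewrite (Rabs_left1 (G s)) by assumption.
        replace (- H * G s) with (- G s * H) by ring.
        apply Rmult_le_compat_l; [lra | apply HH].
  - rewrite (RInt_derivative (fun s => - H * (PI * s - s * s / 2 + cos s))).
    + rewrite cos_PI, cos_2PI. eqR; field.
    + intros s. unfold G. auto_derive; [exact I | eqR; field].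
    + cont. }
assert (B : Rabs (pint (fun s => G s * h (s + t))) <= H * (PI * PI - 4)).
{ unfold pint. rewrite <- (RInt_Chasles _ 0 PI (2 * PI)); try (apply ex_RInt_continuity; cont).
  eapply Rle_trans; [apply Rabs_triang |]. lra. }
rewrite Q in P.
assert (E : 2 * PI * Rabs (z t) <= 2 * PI * m + H * (PI * PI - 4)).
{ rewrite <- (Rabs_pos_eq (2 * PI)) at 1 by lra. rewrite <- Rabs_mult.
  replace (2 * PI * z t) with (pint z - pint (fun s => G s * h (s + t))) by lra.
  unfold Rminus. eapply Rle_trans; [apply Rabs_triang |]. rewrite Rabs_Ropp. lra. }
assert (PI3 : 3 < PI) by (assert (X := PI2_3_2); lra).
(* The ratio [(x^2 - 4) / (2 x)] increases for positive [x] and equals exactly [39 / 40] at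
   [x = 16 / 5]. *)
assert (F : H * (PI * PI - 4) <= H * (2 * PI * (39 / 40))) by (apply Rmult_le_compat_l; nra).
apply Rmult_le_reg_l with (2 * PI); lra.
Qed.

(** * Taylor expansion of the nonlinearity at the origin *)

(** The mean value theorem forgoes the factor [1 / (n + 1)] that integration would gain, but it
    keeps [K] unchanged, so the estimate can be iterated. *)
Lemma growth_of_derivative (F F' : R -> R) (n : nat) (K d : R) :
  (forall x, derivable_pt_lim F x (F' x)) -> F 0 = 0 -> 0 <= K ->
  (forall x, Rabs x < d -> Rabs (F' x) <= K * Rabs x ^ n) ->
  forall x, Rabs x < d -> Rabs (F x) <= K * Rabs x ^ S n.
Proof.
intros HF F0 HK HF' x Hx.
destruct (MVT_abs F F' 0 x) as [c [E Hc]]; [intros; apply HF |].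
rewrite F0, !Rminus_0_r in E. rewrite E.
assert (Hcx : Rabs c <= Rabs x).
{ revert Hc. unfold Rmin, Rmax, Rabs.
  destruct (Rle_dec 0 x), (Rcase_abs c), (Rcase_abs x); intros; lra. }
replace (K * Rabs x ^ S n) with (K * Rabs x ^ n * Rabs x) by (simpl; ring).
apply Rmult_le_compat_r; [apply Rabs_pos |].
eapply Rle_trans; [apply HF'; lra |].
apply Rmult_le_compat_l; [exact HK |].
apply pow_incr. split; [apply Rabs_pos | exact Hcx].
Qed.

(** Continuity of [f3] at 0 bounds [f3 - 6 * C] by [eps] near 0; three applications of
    [growth_of_derivative] lift this to the cubic remainder of [f]. *)
Lemma taylor3 (f f1 f2 f3 : R -> R) (B C : R) :
  is_C3 f f1 f2 f3 -> f 0 = 0 -> f1 0 = 1 -> B = f2 0 / 2 -> C = f3 0 / 6 ->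
  forall eps, 0 < eps -> exists d, 0 < d /\ forall x, Rabs x < d ->
    Rabs (f x - x - B * x ^ 2 - C * x ^ 3) <= eps * Rabs x ^ 3.
Proof.
intros (D1 & D2 & D3 & C3) f0 f10 HB HC eps Heps.
destruct (C3 0 eps Heps) as [d [Hd H3]]. exists d. split; [exact Hd |].
assert (P3 : forall x, Rabs x < d -> Rabs (f3 x - 6 * C) <= eps * Rabs x ^ 0).
{ intros x Hx. simpl. rewrite Rmult_1_r. replace (6 * C) with (f3 0) by lra.
  (* The epsilon-delta form of continuity speaks only of points different from 0. *)
  destruct (Req_dec x 0) as [-> | Hx0]; [rewrite Rminus_diag, Rabs_R0; lra |].
  apply Rlt_le, (H3 x). split.
  - split; [exact I | lra].
  - simpl. unfold R_dist. rewrite Rminus_0_r. exact Hx. }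
apply (growth_of_derivative _ (fun x => f1 x - 1 - 2 * B * x - 3 * C * x ^ 2)).
- intros x. apply is_derive_Reals.
  assert (X := D1 x). apply is_derive_Reals in X.
  auto_derive; [exists (f1 x); exact X |].
  replace (Derive (fun y : R => f y) x) with (f1 x)
    by (symmetry; apply is_derive_unique; exact X).
  eqR; ring.
- rewrite f0. ring.
- lra.
- apply (growth_of_derivative _ (fun x => f2 x - 2 * B - 6 * C * x)).
  + intros x. apply is_derive_Reals. assert (X := D2 x). apply is_derive_Reals in X.
    auto_derive; [exists (f2 x); exact X |].
    replace (Derive (fun y : R => f1 y) x) with (f2 x)
      by (symmetry; apply is_derive_unique; exact X).
    eqR; ring.
  + rewrite f10. ring.
  + lra.
  + apply (growth_of_derivative _ (fun x => f3 x - 6 * C)); [| lra | lra | exact P3].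
    intros x. apply is_derive_Reals. assert (X := D3 x). apply is_derive_Reals in X.
    auto_derive; [exists (f3 x); exact X |].
    replace (Derive (fun y : R => f2 y) x) with (f3 x)
      by (symmetry; apply is_derive_unique; exact X).
    eqR; ring.
Qed.

(** * A bootstrap for sup bounds, and the second-order profile *)

(** The implication is applied to the supremum [Z] of [|z|], which is finite thanks to [N]; then
    [Z <= theta * Z + kappa] is solved for [Z]. *)
Lemma self_improving_bound (z : R -> R) (N theta kappa : R) :
  theta < 1 -> (forall s, Rabs (z s) <= N) ->
  (forall Z, 0 <= Z -> (forall s, Rabs (z s) <= Z) ->
     forall s, Rabs (z s) <= theta * Z + kappa) ->
  forall s, Rabs (z s) <= kappa / (1 - theta).
Proof.
intros Ht HN Himp.
destruct (completeness (fun y => exists s, y = Rabs (z s))) as [Z [Hub Hlub]].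
- exists N. intros y [s ->]. apply HN.
- exists (Rabs (z 0)), 0. reflexivity.
- assert (HZ : forall s, Rabs (z s) <= Z) by (intros s; apply Hub; exists s; reflexivity).
  assert (Z0 : 0 <= Z) by (eapply Rle_trans; [apply Rabs_pos | apply (HZ 0)]).
  assert (HZ2 : Z <= theta * Z + kappa).
  { apply Hlub. intros y [s ->]. now apply Himp. }
  intros s. eapply Rle_trans; [apply HZ |].
  apply Rmult_le_reg_r with (1 - theta); [lra |].
  unfold Rdiv. rewrite Rmult_assoc, Rinv_l by lra. lra.
Qed.

(* Second-order part of a small periodic solution with first mode [A cos s]:
   [A^2 * second_mode B s]. *)
Definition second_mode (B s : R) : R :=
  B * (- (2 / 5) - cos s * cos s / 5 + 2 * (sin s * cos s) / 5).

Definition second_mode' (B s : R) : R :=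
  B * (2 * (sin s * cos s) / 5 + 2 * (cos s * cos s - sin s * sin s) / 5).

Lemma is_derive_second_mode (B s : R) :
  is_derive (second_mode B) s (second_mode' B s).
Proof.
unfold second_mode, second_mode'. auto_derive; [exact I | eqR; field].
Qed.

(** This is the equation for the [A^2] coefficient at [lam = 1], [cos w = 0]: there
    [V' (s + w) = - (V s + B cos^2 s)], and the shift by [w] negates [V']. *)
Lemma second_mode_eq (B s : R) :
  second_mode B s + B * (cos s * cos s) = second_mode' B s.
Proof.
unfold second_mode, second_mode'. assert (E := sin_cos_sq s).
replace (sin s * sin s) with (1 - cos s * cos s) by lra. field.
Qed.

Lemma Rabs_cos_le (s : R) : Rabs (cos s) <= 1.
Proof. apply Rabs_le. exact (COS_bound s). Qed.
Lemma Rabs_sin_le (s : R) : Rabs (sin s) <= 1.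
Proof. apply Rabs_le. exact (SIN_bound s). Qed.

Lemma Rabs_second_mode (B s : R) : Rabs (second_mode B s) <= Rabs B.
Proof.
unfold second_mode. rewrite Rabs_mult. rewrite <- (Rmult_1_r (Rabs B)) at 2.
apply Rmult_le_compat_l; [apply Rabs_pos |].
assert (E := sin_cos_sq s). apply Rabs_le. split; nra.
Qed.

Lemma continuity_second_mode (B : R) : continuity (second_mode B).
Proof. exact (continuity_derive _ _ (is_derive_second_mode B)). Qed.

(** [second_mode'] consists of second harmonics only, which a shift by an odd multiple of [PI / 2]
    negates. The sum thus vanishes at [lam = 1], [cos w = 0], and its size is linear in the distance
    from there. *)
Lemma second_mode_shift (B lam w d s : R) :
  0 <= d <= 1 -> Rabs (lam - 1) <= d -> Rabs (cos w) <= d ->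
  Rabs (lam * second_mode' B (s + w) + second_mode' B s) <= 10 * Rabs B * d.
Proof.
intros Hd Hl Hw.
assert (E := sin_cos_sq s). assert (Ew := sin_cos_sq w).
(* Double angles: [p = sin 2s], [q = cos 2s], [x = 1 + lam cos 2w] and [y = lam sin 2w]; both [x]
   and [y] are of order [d]. *)
set (p := 2 * (sin s * cos s)). set (q := cos s * cos s - sin s * sin s).
set (x := lam * (2 * (cos w * cos w)) - (lam - 1)). set (y := lam * (2 * (sin w * cos w))).
replace (lam * second_mode' B (s + w) + second_mode' B s)
  with (B * ((p + 2 * q) * x / 5 + (q - 2 * p) * y / 5)).
2: { unfold second_mode', p, q, x, y. rewrite sin_plus, cos_plus.
     apply Rminus_diag_uniq.
     transitivity (B * lam / 5 * (sin w * sin w + cos w * cos w - 1)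
        * (2 * (sin s * cos s) + 2 * (cos s * cos s - sin s * sin s))).
     - field.
     - rewrite Ew. field. }
rewrite Rabs_mult.
replace (10 * Rabs B * d) with (Rabs B * (10 * d)) by ring.
apply Rmult_le_compat_l; [apply Rabs_pos |].
assert (Hp : Rabs p <= 1).
{ assert (X := Rle_0_sqr (sin s + cos s)). assert (Y := Rle_0_sqr (sin s - cos s)).
  unfold Rsqr in X, Y. apply Rabs_le; unfold p; lra. }
assert (Hq : Rabs q <= 1).
{ assert (X := Rle_0_sqr (sin s)). assert (Y := Rle_0_sqr (cos s)).
  unfold Rsqr in X, Y. apply Rabs_le; unfold q; lra. }
apply Rabs_le_between in Hl.
assert (Hlam : Rabs lam <= 2) by (apply Rabs_le; lra).
assert (Hx : Rabs x <= 5 * d).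
{ unfold x. unfold Rminus at 1. eapply Rle_trans; [apply Rabs_triang |].
  rewrite Rabs_Ropp, !Rabs_mult, (Rabs_pos_eq 2) by lra.
  assert (Rabs (lam - 1) <= d) by (apply Rabs_le; lra).
  assert (Rabs (cos w) * Rabs (cos w) <= d * 1).
  { apply Rmult_le_compat; try apply Rabs_pos; [exact Hw | apply Rabs_cos_le]. }
  assert (Rabs lam * (2 * (Rabs (cos w) * Rabs (cos w))) <= 2 * (2 * (d * 1))).
  { apply Rmult_le_compat; [apply Rabs_pos | | exact Hlam | lra].
    assert (Y := Rabs_pos (cos w)). nra. }
  lra. }
assert (Hy : Rabs y <= 4 * d).
{ unfold y. rewrite !Rabs_mult, (Rabs_pos_eq 2) by lra.
  assert (Rabs (sin w) * Rabs (cos w) <= 1 * d).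
  { apply Rmult_le_compat; try apply Rabs_pos; [apply Rabs_sin_le | exact Hw]. }
  replace (4 * d) with (2 * (2 * (1 * d))) by ring.
  apply Rmult_le_compat; [apply Rabs_pos | | exact Hlam | lra].
  assert (Y := Rabs_pos (cos w)). assert (Y' := Rabs_pos (sin w)). nra. }
assert (A1 : Rabs ((p + 2 * q) * x) <= 3 * (5 * d)).
{ rewrite Rabs_mult. apply Rmult_le_compat; try apply Rabs_pos; [| exact Hx].
  apply Rabs_le. apply Rabs_le_between in Hp. apply Rabs_le_between in Hq. lra. }
assert (A2 : Rabs ((q - 2 * p) * y) <= 3 * (4 * d)).
{ rewrite Rabs_mult. apply Rmult_le_compat; try apply Rabs_pos; [| exact Hy].
  apply Rabs_le. apply Rabs_le_between in Hp. apply Rabs_le_between in Hq. lra. }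
apply Rabs_le_between in A1. apply Rabs_le_between in A2. apply Rabs_le. lra.
Qed.

(** * The rescaled equation and its Fourier projections *)

(** The delay is written as an advance, so that [f (u s)] enters integrals over a period without a
    shift. *)
Definition delayed_profile (f : R -> R) (lam w : R) (u : R -> R) : Prop :=
  (forall s, is_derive u (s + w) (- f (u s) / lam)) /\
  (forall s, u (s + 2 * PI) = u s).

Lemma profile_continuity (f : R -> R) (lam w : R) (u : R -> R) :
  delayed_profile f lam w u -> continuity u.
Proof.
intros [Hu _]. apply (continuity_derive u (fun s => - f (u (s - w)) / lam)).
intros s. replace s with (s - w + w) at 1 by ring. apply Hu.
Qed.

(** The derivatives of [u (s + w)] times 1, [sin s] and [cos s] integrate to 0 over a period.
    Translation invariance moves the shift onto the test function, where it rotates the first mode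
    by [w]. *)
Lemma profile_projections (f : R -> R) (lam w : R) (u : R -> R) (A : R) :
  continuity f -> lam <> 0 -> delayed_profile f lam w u ->
  pint (fun s => u s * sin s) = 0 -> pint (fun s => u s * cos s) = PI * A ->
  pint (fun s => f (u s)) = 0 /\
  pint (fun s => f (u s) * cos s) = lam * sin w * (PI * A) /\
  pint (fun s => f (u s) * sin s) = lam * cos w * (PI * A).
Proof.
intros Cf Hl Hu Hs Hc. assert (Cu := profile_continuity _ _ _ _ Hu).
destruct Hu as [Hu Hp].
assert (Cg : continuity (fun s => f (u s))) by exact (continuity_comp u f Cu Cf).
assert (DU : forall s, is_derive (fun s => u (s + w)) s (- f (u s) / lam)).
{ intros s. evar_last.
  - apply (is_derive_comp u (fun s => s + w)); [apply Hu |].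
    auto_derive; [exact I | reflexivity].
  - change scal with Rmult. eqR. ring. }
assert (Shift : forall c, continuity c -> (forall s, c (s + 2 * PI) = c s) ->
  pint (fun s => u (s + w) * c s) = pint (fun s => u s * c (s + - w))).
{ intros c Cc Hcp. rewrite <- (pint_translate (fun s => u s * c (s + - w)) w).
  - apply pint_ext. intros s. do 2 f_equal. ring.
  - cont.
  - intros s. rewrite Hp. f_equal. rewrite <- (Hcp (s + - w)). f_equal. ring. }
assert (Es : pint (fun s => u (s + w) * sin s) = - sin w * (PI * A)).
{ rewrite (Shift sin); [| cont |].
  - transitivity (pint (fun s => cos w * (u s * sin s) - sin w * (u s * cos s))).
    + apply pint_ext; intros s. rewrite sin_plus, cos_neg, sin_neg. ring.
    + rewrite pint_sub, !pint_scal, Hs, Hc by cont. ring.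
  - intros s. rewrite sin_plus, cos_2PI, sin_2PI. ring. }
assert (Ec : pint (fun s => u (s + w) * cos s) = cos w * (PI * A)).
{ rewrite (Shift cos); [| cont |].
  - transitivity (pint (fun s => cos w * (u s * cos s) + sin w * (u s * sin s))).
    + apply pint_ext; intros s. rewrite cos_plus, cos_neg, sin_neg. ring.
    + rewrite pint_add, !pint_scal, Hs, Hc by cont. ring.
  - intros s. rewrite cos_plus, cos_2PI, sin_2PI. ring. }
assert (U2 : u (2 * PI + w) = u (0 + w)) by (rewrite Rplus_comm, Hp; f_equal; ring).
split; [| split].
- assert (P : pint (fun s => - / lam * f (u s)) = 0).
  { unfold pint. rewrite (RInt_derivative (fun s => u (s + w))).
    - rewrite U2. eqR. ring.
    - intros s. replace (- / lam * f (u s)) with (- f (u s) / lam) by (field; exact Hl). apply DU.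
    - cont. }
  rewrite pint_scal in P by cont.
  apply Rmult_integral in P. destruct P as [P | P]; [| exact P].
  exfalso. revert P. now apply Ropp_neq_0_compat, Rinv_neq_0_compat.
- assert (P : pint (fun s => - / lam * (f (u s) * cos s) - u (s + w) * sin s) = 0).
  { unfold pint. rewrite (RInt_derivative (fun s => u (s + w) * cos s)).
    - rewrite U2, cos_2PI, cos_0. eqR. ring.
    - intros s. evar_last.
      + apply (is_derive_mult (fun s => u (s + w)) cos); [apply DU | apply is_derive_cos |].
        intros; apply Rmult_comm.
      + change Hierarchy.plus with Rplus; change mult with Rmult. cbv beta. eqR. field. exact Hl.
    - cont. }
  rewrite pint_sub, pint_scal, Es in P by cont.
  apply Rmult_eq_reg_l with (- / lam); [| now apply Ropp_neq_0_compat, Rinv_neq_0_compat].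
  rewrite (Rminus_diag_uniq _ _ P). field. exact Hl.
- assert (P : pint (fun s => - / lam * (f (u s) * sin s) + u (s + w) * cos s) = 0).
  { unfold pint. rewrite (RInt_derivative (fun s => u (s + w) * sin s)).
    - rewrite U2, sin_2PI, sin_0. eqR. ring.
    - intros s. evar_last.
      + apply (is_derive_mult (fun s => u (s + w)) sin); [apply DU | apply is_derive_sin |].
        intros; apply Rmult_comm.
      + change Hierarchy.plus with Rplus; change mult with Rmult. cbv beta. eqR. field. exact Hl.
    - cont. }
  rewrite pint_add, pint_scal, Ec in P by cont.
  apply Rmult_eq_reg_l with (- / lam); [| now apply Ropp_neq_0_compat, Rinv_neq_0_compat].
  replace (- / lam * pint (fun s => f (u s) * sin s)) with (- (cos w * (PI * A))) by lra.
  field. exact Hl.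
Qed.

(** * Pointwise error of the quadratic approximation *)

(** Since [U^2 - v^2 = y (U + v)], replacing [U] by its first mode [v] in the square costs a factor
    [d] times the size of [y]. The small factor in front of [Z] later lets the bootstrap absorb this
    error. *)
Lemma quadratic_error (B kappa d A v y U g Z : R) :
  0 < d <= 1 -> 0 <= kappa -> 0 <= Z -> Rabs v <= Rabs A -> Rabs A <= 2 * d ->
  Rabs U <= d -> U = v + y -> Rabs y <= Rabs B * (A * A) + Z ->
  Rabs (g - U - B * U ^ 2) <= kappa * Rabs U ^ 3 ->
  Rabs (g - U - B * (v * v)) <= 3 * (Rabs B + 1) * (kappa + Rabs B) * d * (A * A + Z).
Proof.
intros Hd Hk HZ Hv HA HU EU Hy Hg.
assert (b0 := Rabs_pos B). set (b := Rabs B) in *.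
set (Y := b * (A * A) + Z) in *.
assert (A0 : 0 <= A * A) by nra.
assert (HY : Y <= (b + 1) * (A * A + Z)) by (unfold Y; nra).
assert (Y0 : 0 <= Y) by (unfold Y; nra).
assert (HUv : Rabs (y * (U + v)) <= 3 * d * Y).
{ rewrite Rabs_mult. rewrite Rmult_comm. apply Rmult_le_compat; try apply Rabs_pos; [| exact Hy].
  eapply Rle_trans; [apply Rabs_triang | lra]. }
assert (Hvv : v * v <= A * A).
{ apply Rsqr_le_abs_1 in Hv. exact Hv. }
assert (HU3 : Rabs U ^ 3 <= d * (A * A + 3 * Y)).
{ replace (Rabs U ^ 3) with (Rabs U * (Rabs U * Rabs U)) by ring.
  apply Rmult_le_compat; try apply Rabs_pos; [| exact HU |].
  - apply Rmult_le_pos; apply Rabs_pos.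
  - rewrite <- Rabs_mult, Rabs_pos_eq by nra.
    replace (U * U) with (v * v + y * (U + v)) by (rewrite EU; ring).
    apply Rabs_le_between in HUv. nra. }
assert (H1 : kappa * Rabs U ^ 3 <= kappa * (3 * (b + 1) * d * (A * A + Z))).
{ apply Rmult_le_compat_l; [exact Hk |].
  eapply Rle_trans; [exact HU3 |].
  replace (3 * (b + 1) * d * (A * A + Z)) with (d * (3 * (b + 1) * (A * A + Z))) by ring.
  apply Rmult_le_compat_l; [lra |]. unfold Y. nra. }
assert (H2 : Rabs (B * (y * (U + v))) <= b * (3 * (b + 1) * d * (A * A + Z))).
{ rewrite Rabs_mult. fold b. apply Rmult_le_compat_l; [exact b0 |].
  eapply Rle_trans; [exact HUv |].
  replace (3 * (b + 1) * d * (A * A + Z)) with (3 * d * ((b + 1) * (A * A + Z))) by ring.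
  apply Rmult_le_compat_l; lra. }
replace (g - U - B * (v * v)) with ((g - U - B * U ^ 2) + B * (y * (U + v)))
  by (rewrite EU; ring).
eapply Rle_trans; [apply Rabs_triang |]. lra.
Qed.

(** * Explicit trigonometric integrals *)

(** With sine and cosine generalized to [S] and [c], checking the antiderivative is a polynomial
    identity modulo [S^2 + c^2 = 1]. *)
Ltac antiderivative F :=
  unfold pint; rewrite (RInt_derivative F);
  [ rewrite ?sin_0, ?cos_0, ?sin_2PI, ?cos_2PI; eqR; field
  | let s := fresh "s" in let E := fresh "E" in
    intros s; assert (E := sin_cos_sq s);
    unfold second_mode; auto_derive; [exact I | eqR];
    generalize dependent (cos s); generalize (sin s);
    let S := fresh "S" in let c := fresh "c" in intros S c E;
    assert (S * S = 1 - c * c) by lra; field_simplify;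
    replace (S ^ 2) with (1 - c * c) by (simpl; lra); field
  | cont ].

Lemma pint_cos_cos : pint (fun s => cos s * cos s) = PI.
Proof. antiderivative (fun s => (s + sin s * cos s) / 2). Qed.

Lemma pint_cos_sin : pint (fun s => cos s * sin s) = 0.
Proof. antiderivative (fun s => sin s * sin s / 2). Qed.

Lemma pint_cos2_cos : pint (fun s => cos s * cos s * cos s) = 0.
Proof. antiderivative (fun s => sin s - sin s * sin s * sin s / 3). Qed.

Lemma pint_cos2_sin : pint (fun s => cos s * cos s * sin s) = 0.
Proof. antiderivative (fun s => - (cos s * cos s * cos s) / 3). Qed.

Lemma pint_cos3_cos : pint (fun s => cos s * cos s * cos s * cos s) = 3 / 4 * PI.
Proof.
antiderivative (fun s => 3 * s / 8 + 3 / 8 * (sin s * cos s)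
  + sin s * (cos s * cos s * cos s) / 4).
Qed.

Lemma pint_cos3_sin : pint (fun s => cos s * cos s * cos s * sin s) = 0.
Proof. antiderivative (fun s => - (cos s * cos s * cos s * cos s) / 4). Qed.

(** This mean cancels that of [B cos^2 s], as the vanishing mean of [f (u s)] demands at second
    order. *)
Lemma pint_second_mode (B : R) : pint (second_mode B) = - B * PI.
Proof.
assert (CV := continuity_second_mode B).
antiderivative (fun s => B * (- (2 / 5) * s - (s + sin s * cos s) / 10 + sin s * sin s / 5)).
Qed.

Lemma pint_second_mode_cos (B : R) : pint (fun s => second_mode B s * cos s) = 0.
Proof.
assert (CV := continuity_second_mode B).
antiderivative (fun s => B * (- (2 / 5) * sin s - (sin s - sin s * sin s * sin s / 3) / 5
  - 2 / 15 * (cos s * cos s * cos s))).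
Qed.

Lemma pint_second_mode_sin (B : R) : pint (fun s => second_mode B s * sin s) = 0.
Proof.
assert (CV := continuity_second_mode B).
antiderivative (fun s => B * (2 / 5 * cos s + cos s * cos s * cos s / 15
  + 2 / 15 * (sin s * sin s * sin s))).
Qed.

(** Multiplied by [2 * B / PI], this value is the coefficient [- 11 / 10 * B ^ 2] of the cosine
    projection; its sine counterpart below gives [B ^ 2 / 5] in the same way. *)
Lemma pint_second_mode_cos_cos (B : R) :
  pint (fun s => second_mode B s * (cos s * cos s)) = - (11 / 20) * B * PI.
Proof.
assert (CV := continuity_second_mode B).
antiderivative (fun s => B * (- (2 / 5) * ((s + sin s * cos s) / 2)
  - (3 * s / 8 + 3 / 8 * (sin s * cos s) + sin s * (cos s * cos s * cos s) / 4) / 5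
  - cos s * cos s * cos s * cos s / 10)).
Qed.

Lemma pint_second_mode_cos_sin (B : R) :
  pint (fun s => second_mode B s * (cos s * sin s)) = B * PI / 10.
Proof.
assert (CV := continuity_second_mode B).
antiderivative (fun s => B * (- (1 / 5) * (sin s * sin s) + cos s * cos s * cos s * cos s / 20
  + 2 / 5 * ((s + sin s * cos s) / 2
     - (3 * s / 8 + 3 / 8 * (sin s * cos s) + sin s * (cos s * cos s * cos s) / 4)))).
Qed.

(** * Uniform remainder after the second-order approximation *)

Lemma amplitude_bound (u : R -> R) (A d : R) :
  continuity u -> (forall s, Rabs (u s) <= d) ->
  pint (fun s => u s * cos s) = PI * A -> Rabs A <= 2 * d.
Proof.
intros Cu Hu HA. assert (HP := PI_RGT_0).
assert (X : Rabs (pint (fun s => u s * cos s)) <= 2 * PI * d).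
{ apply pint_bound; [cont |]. intros s. rewrite Rabs_mult, <- (Rmult_1_r d).
  apply Rmult_le_compat; try apply Rabs_pos; [apply Hu | apply Rabs_cos_le]. }
rewrite HA, Rabs_mult, (Rabs_pos_eq PI) in X by lra.
apply Rmult_le_reg_l with PI; lra.
Qed.

(** The remainder [z] solves the linearized equation up to errors of order [d (A^2 + Z)], where [Z]
    bounds [|z|]. As [z] has no first mode and a small mean, [high_mode_bound] returns a bound
    [99 / 100 * Z] plus a multiple of [d A^2], and [self_improving_bound] concludes. *)
Lemma remainder_bound (f u : R -> R) (B kappa lam w d A : R) :
  continuity f -> 0 <= kappa ->
  (forall x, Rabs x <= d -> Rabs (f x - x - B * x ^ 2) <= kappa * Rabs x ^ 3) ->
  0 < d <= 1 / 100 -> 3 * (Rabs B + 1) * (kappa + Rabs B) * d <= 1 / 1200 ->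
  Rabs (lam - 1) <= d -> Rabs (cos w) <= d ->
  delayed_profile f lam w u -> (forall s, Rabs (u s) <= d) ->
  pint (fun s => u s * sin s) = 0 -> pint (fun s => u s * cos s) = PI * A ->
  forall s, Rabs (u s - A * cos s - A * A * second_mode B s) <=
    100 * (6 * (3 * (Rabs B + 1) * (kappa + Rabs B)) + 10 * Rabs B) * d * (A * A).
Proof.
intros Cf Hk Hf Hd HKd Hl Hw Hu Hud Hs Hc.
assert (HP := PI_RGT_0).
assert (Cu := profile_continuity _ _ _ _ Hu).
assert (CV := continuity_second_mode B).
assert (Cg : continuity (fun s => f (u s))) by exact (continuity_comp u f Cu Cf).
assert (HA := amplitude_bound u A d Cu Hud Hc).
assert (Hl' := Hl). apply Rabs_le_between in Hl'.
assert (l0 : lam <> 0) by lra.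
destruct (profile_projections f lam w u A Cf l0 Hu Hs Hc) as (P0 & Pc & Ps).
destruct Hu as [Hu Hp].
assert (b0 := Rabs_pos B). set (b := Rabs B) in *.
set (K := 3 * (b + 1) * (kappa + b)) in *.
assert (K0 : 0 <= K) by (unfold K; nra).
assert (A0 : 0 <= A * A) by nra.
set (z := fun s => u s - A * cos s - A * A * second_mode B s).
intros s0.
replace (100 * (6 * K + 10 * b) * d * (A * A))
  with ((6 * K + 10 * b) * d * (A * A) / (1 - 99 / 100)) by field.
apply (self_improving_bound z (d + 2 * d + A * A * b)); [lra | |].
{ intros s. unfold z, Rminus. eapply Rle_trans; [apply Rabs_triang |].
  apply Rplus_le_compat; [eapply Rle_trans; [apply Rabs_triang |]; apply Rplus_le_compat |].
  - apply Hud.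
  - rewrite Rabs_Ropp, Rabs_mult, <- (Rmult_1_r (2 * d)).
    apply Rmult_le_compat; try apply Rabs_pos; [exact HA | apply Rabs_cos_le].
  - rewrite Rabs_Ropp, Rabs_mult, (Rabs_pos_eq (A * A)) by exact A0.
    apply Rmult_le_compat_l; [exact A0 | apply Rabs_second_mode]. }
intros Z HZ0 HZ.
set (e := fun s => f (u s) - u s - B * (A * A) * (cos s * cos s)).
assert (Ce : continuity e) by (unfold e; cont).
set (E := K * d * (A * A + Z)).
assert (E0 : 0 <= E) by (unfold E; apply Rmult_le_pos; [apply Rmult_le_pos |]; lra).
assert (He : forall s, Rabs (e s) <= E).
{ intros s. unfold e.
  replace (B * (A * A) * (cos s * cos s)) with (B * ((A * cos s) * (A * cos s))) by ring.
  apply (quadratic_error B kappa d A (A * cos s) (u s - A * cos s)); try lra.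
  - rewrite Rabs_mult. rewrite <- (Rmult_1_r (Rabs A)) at 2.
    apply Rmult_le_compat_l; [apply Rabs_pos | apply Rabs_cos_le].
  - apply Hud.
  - replace (u s - A * cos s) with (A * A * second_mode B s + z s) by (unfold z; ring).
    eapply Rle_trans; [apply Rabs_triang |]. apply Rplus_le_compat; [| apply HZ].
    rewrite Rabs_mult, (Rabs_pos_eq (A * A)), Rmult_comm by exact A0.
    apply Rmult_le_compat_r; [exact A0 | apply Rabs_second_mode].
  - apply Hf, Hud. }
assert (Bm : forall c, continuity c -> (forall s, Rabs (c s) <= 1) ->
  Rabs (pint (fun s => e s * c s)) <= 2 * PI * E).
{ intros c Cc Hc1. apply pint_bound; [cont |]. intros s.
  rewrite Rabs_mult, <- (Rmult_1_r E).
  apply Rmult_le_compat; try apply Rabs_pos; [apply He | apply Hc1]. }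
(* Projecting [e] on the first mode controls the two detunings [lam * sin w - 1] and [lam * cos w],
   which drive the equation for [z]. *)
assert (Bc : Rabs ((lam * sin w - 1) * A) <= 2 * E).
{ assert (X : pint (fun s => e s * cos s) = PI * ((lam * sin w - 1) * A)).
  { transitivity (pint (fun s => f (u s) * cos s - u s * cos s
       - B * (A * A) * (cos s * cos s * cos s))).
    - apply pint_ext; intros s. unfold e. ring.
    - rewrite !pint_sub, pint_scal, Pc, Hc, pint_cos2_cos by cont. ring. }
  assert (Y := Bm cos continuity_cos Rabs_cos_le).
  rewrite X, Rabs_mult, (Rabs_pos_eq PI) in Y by lra.
  apply Rmult_le_reg_l with PI; lra. }
assert (Bs : Rabs (lam * cos w * A) <= 2 * E).
{ assert (X : pint (fun s => e s * sin s) = PI * (lam * cos w * A)).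
  { transitivity (pint (fun s => f (u s) * sin s - u s * sin s
       - B * (A * A) * (cos s * cos s * sin s))).
    - apply pint_ext; intros s. unfold e. ring.
    - rewrite !pint_sub, pint_scal, Ps, Hs, pint_cos2_sin by cont. ring. }
  assert (Y := Bm sin continuity_sin Rabs_sin_le).
  rewrite X, Rabs_mult, (Rabs_pos_eq PI) in Y by lra.
  apply Rmult_le_reg_l with PI; lra. }
(* [f (u s)] has mean zero and the second-order means cancel, so the means of [z] and [e] are
   opposite. *)
assert (Mz : Rabs (pint z) <= 2 * PI * E).
{ assert (X : pint z = - pint e).
  { assert (Xe : pint e = pint (fun s => f (u s)) - pint u - B * (A * A) * PI).
    { unfold e. rewrite !pint_sub, pint_scal, pint_cos_cos by cont. reflexivity. }
    unfold z. rewrite !pint_sub, !pint_scal, pint_second_mode, Xe, P0 by cont.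
    assert (pint cos = 0) as ->.
    { unfold pint. rewrite (RInt_derivative sin);
        [rewrite sin_2PI, sin_0; eqR; ring | apply is_derive_sin | cont]. }
    change (pint (fun s => u s)) with (pint u). ring. }
  rewrite X, Rabs_Ropp. apply pint_bound; assumption. }
set (h := fun s => - f (u (s - w)) / lam + A * sin s - A * A * second_mode' B s).
assert (Ch : continuity h).
{ unfold h. apply continuity_sub; [apply continuity_add |].
  - apply (continuity_mul (fun s => - f (u (s - w))) (fun _ => / lam)); [| cont].
    apply (continuity_opp (fun s => f (u (s - w)))).
    exact (continuity_translate (fun s => f (u s)) (- w) Cg).
  - cont.
  - unfold second_mode'. unfold Rdiv. cont. }
assert (Dz : forall s, is_derive z s (h s)).
{ intros s. unfold z, h.
  apply (is_derive_minus (fun s => u s - A * cos s) (fun s => A * A * second_mode B s)).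
  - replace (- f (u (s - w)) / lam + A * sin s)
      with (- f (u (s - w)) / lam - A * (- sin s)) by ring.
    apply (is_derive_minus u (fun s => A * cos s)).
    + replace s with (s - w + w) at 1 by ring. apply Hu.
    + apply (is_derive_scal cos). apply is_derive_cos.
  - apply (is_derive_scal (second_mode B)). apply is_derive_second_mode. }
assert (Bh : forall s, Rabs (h s) <= 100 / 99 * (Z + 5 * E + 10 * b * d * (A * A))).
{ intros s. replace s with (s - w + w) by ring. set (r := s - w).
  (* The equation for [z]: [second_mode_eq] has absorbed the term [B A^2 cos^2 r], and everything
     after [- z r] is small. Dividing by [lam >= 99 / 100] produces the factor [100 / 99]. *)
  assert (X : lam * h (r + w) = - z r - e r + (lam * sin w - 1) * A * cos r
     + lam * cos w * A * sin r
     - A * A * (lam * second_mode' B (r + w) + second_mode' B r)).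
  { unfold h, z, e. rewrite <- (second_mode_eq B r). replace (r + w - w) with r by ring.
    rewrite (sin_plus r w). field. exact l0. }
  assert (Y : Rabs (lam * h (r + w)) <= Z + E + 2 * E * 1 + 2 * E * 1 + A * A * (10 * b * d)).
  { rewrite X. unfold Rminus.
    repeat (eapply Rle_trans; [apply Rabs_triang | apply Rplus_le_compat]).
    - rewrite Rabs_Ropp. apply HZ.
    - rewrite Rabs_Ropp. apply He.
    - rewrite Rabs_mult. apply Rmult_le_compat; try apply Rabs_pos; [exact Bc | apply Rabs_cos_le].
    - rewrite Rabs_mult. apply Rmult_le_compat; try apply Rabs_pos; [exact Bs | apply Rabs_sin_le].
    - rewrite Rabs_Ropp, Rabs_mult, (Rabs_pos_eq (A * A)) by exact A0.
      apply Rmult_le_compat_l; [exact A0 |]. apply second_mode_shift; [lra | exact Hl | exact Hw]. }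
  rewrite Rabs_mult, (Rabs_pos_eq lam) in Y by lra.
  assert (H0 := Rabs_pos (h (r + w))). nra. }
intros t.
assert (Cz : continuity z) by exact (continuity_derive z h Dz).
eapply Rle_trans.
{ apply (high_mode_bound z h _ E Dz Ch) with (3 := Mz) (2 := Bh).
  - intros s. unfold z, second_mode. rewrite Hp, sin_plus, cos_plus, sin_2PI, cos_2PI.
    rewrite !Rmult_0_r, !Rmult_1_r, Rminus_0_r, Rplus_0_r. reflexivity.
  - transitivity (pint (fun s => u s * cos s - A * (cos s * cos s)
        - A * A * (second_mode B s * cos s))).
    + apply pint_ext; intros s. unfold z. ring.
    + rewrite !pint_sub, !pint_scal, Hc, pint_cos_cos, pint_second_mode_cos by cont. ring.
  - transitivity (pint (fun s => u s * sin s - A * (cos s * sin s)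
        - A * A * (second_mode B s * sin s))).
    + apply pint_ext; intros s. unfold z. ring.
    + rewrite !pint_sub, !pint_scal, Hs, pint_cos_sin, pint_second_mode_sin by cont. ring. }
(* The constants close because [39 / 40 * 100 / 99 + 1 / 200 < 99 / 100]. *)
assert (E6 : 6 * E <= 6 * K * d * (A * A) + 1 / 200 * Z).
{ unfold E. assert (K * d * Z <= 1 / 1200 * Z) by (apply Rmult_le_compat_r; assumption). lra. }
assert (0 <= b * d * (A * A)) by (apply Rmult_le_pos; [apply Rmult_le_pos; lra | exact A0]).
lra.
Qed.

(** * Third-order expansion of the first-mode equations *)

(** With [y = A^2 V + z], the square is [U^2 = v^2 + 2 A^2 v V + 2 v z + y^2], and [U^3 - v^3] has
    the factor [y]. Every discarded term carries, besides [|A|^3], a factor [d] or [eps]. *)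
Lemma cubic_error (B C A v V z U g d rho eps : R) :
  0 < d -> 0 <= rho -> rho * d <= 1 -> 2 * (Rabs B + 1) * d <= 1 ->
  Rabs v <= Rabs A -> Rabs A <= 2 * d -> Rabs V <= Rabs B ->
  Rabs z <= rho * d * (A * A) -> U = v + A * A * V + z -> 0 <= eps ->
  Rabs (g - U - B * U ^ 2 - C * U ^ 3) <= eps * Rabs U ^ 3 ->
  Rabs (g - U - B * (v * v) - 2 * B * (A * A) * (v * V) - C * (v * v * v)) <=
    (8 * eps + d * (Rabs B * (2 * rho + 2 * (Rabs B + 1) ^ 2)
       + 14 * Rabs C * (Rabs B + 1))) * Rabs A ^ 3.
Proof.
intros Hd Hr Hrd Hbd Hv HA HV Hz EU He Hg.
assert (b0 := Rabs_pos B). assert (c0 := Rabs_pos C). assert (a0 := Rabs_pos A).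
assert (v0 := Rabs_pos v).
assert (EA : A * A = Rabs A * Rabs A) by (rewrite <- Rabs_mult, Rabs_pos_eq; [reflexivity | nra]).
set (b := Rabs B) in *. set (c := Rabs C) in *. set (a := Rabs A) in *.
set (y := A * A * V + z).
assert (Hy : Rabs y <= (b + 1) * (a * a)).
{ unfold y. eapply Rle_trans; [apply Rabs_triang |].
  rewrite Rabs_mult, (Rabs_pos_eq (A * A)), EA by nra. rewrite EA in Hz.
  assert (a * a * Rabs V <= a * a * b) by (apply Rmult_le_compat_l; [nra | exact HV]).
  assert (rho * d * (a * a) <= 1 * (a * a)) by (apply Rmult_le_compat_r; [nra | exact Hrd]).
  lra. }
assert (Hya : (b + 1) * (a * a) <= a) by nra.
assert (y0 := Rabs_pos y).
assert (EU' : U = v + y) by (unfold y; lra).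
assert (HU : Rabs U <= 2 * a) by (rewrite EU'; eapply Rle_trans; [apply Rabs_triang | lra]).
assert (U0 := Rabs_pos U).
assert (T0 : eps * Rabs U ^ 3 <= 8 * eps * a ^ 3).
{ replace (8 * eps * a ^ 3) with (eps * (2 * a) ^ 3) by ring.
  apply Rmult_le_compat_l; [exact He | apply pow_incr; lra]. }
assert (T1 : Rabs (B * (2 * v * z)) <= b * (2 * a * (rho * d * (a * a)))).
{ rewrite !Rabs_mult, (Rabs_pos_eq 2) by lra. rewrite EA in Hz.
  apply Rmult_le_compat_l; [exact b0 |].
  apply Rmult_le_compat; [lra | apply Rabs_pos | lra | exact Hz]. }
assert (T2 : Rabs (B * (y * y)) <= b * ((b + 1) * (a * a) * ((b + 1) * (a * (2 * d))))).
{ rewrite !Rabs_mult. apply Rmult_le_compat_l; [exact b0 |].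
  apply Rmult_le_compat; try assumption.
  eapply Rle_trans; [exact Hy |]. apply Rmult_le_compat_l; [lra |].
  apply Rmult_le_compat_l; assumption. }
assert (T3 : Rabs (C * (y * (U * U + U * v + v * v))) <=
  c * ((b + 1) * (a * (2 * d)) * (7 * (a * a)))).
{ rewrite Rabs_mult. apply Rmult_le_compat_l; [exact c0 |].
  rewrite Rabs_mult. apply Rmult_le_compat; try apply Rabs_pos.
  - eapply Rle_trans; [exact Hy |]. apply Rmult_le_compat_l; [lra |].
    apply Rmult_le_compat_l; assumption.
  - assert (Rabs U * Rabs U <= 2 * a * (2 * a)) by (apply Rmult_le_compat; assumption).
    assert (Rabs U * Rabs v <= 2 * a * a) by (apply Rmult_le_compat; assumption).
    assert (Rabs v * Rabs v <= a * a) by (apply Rmult_le_compat; assumption).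
    eapply Rle_trans; [apply Rabs_triang |].
    assert (Rabs (U * U + U * v) <= Rabs U * Rabs U + Rabs U * Rabs v)
      by (rewrite <- !Rabs_mult; apply Rabs_triang).
    rewrite (Rabs_mult v v). lra. }
replace (g - U - B * (v * v) - 2 * B * (A * A) * (v * V) - C * (v * v * v))
  with ((g - U - B * U ^ 2 - C * U ^ 3) + B * (2 * v * z) + B * (y * y)
        + C * (y * (U * U + U * v + v * v)))
  by (rewrite EU'; unfold y; ring).
eapply Rle_trans.
{ eapply Rle_trans; [apply Rabs_triang | apply Rplus_le_compat; [| exact T3]].
  eapply Rle_trans; [apply Rabs_triang | apply Rplus_le_compat; [| exact T2]].
  eapply Rle_trans; [apply Rabs_triang | apply Rplus_le_compat; [| exact T1]].
  eapply Rle_trans; [exact Hg | exact T0]. }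
apply Req_le. ring.
Qed.

Lemma small_factor (D X Y : R) : 0 < D -> 0 <= X -> 0 < Y ->
  exists d, 0 < d <= D /\ forall d', d' <= d -> X * d' <= Y.
Proof.
intros HD HX HY. exists (Rmin D (Y / (X + 1))).
assert (0 < Y / (X + 1)) by (apply Rdiv_lt_0_compat; lra).
split; [split; [now apply Rmin_glb_lt | apply Rmin_l] |].
intros d' Hd'. apply Rle_trans with (X * (Y / (X + 1))).
- apply Rmult_le_compat_l; [exact HX |]. eapply Rle_trans; [exact Hd' | apply Rmin_r].
- apply Rmult_le_reg_r with (X + 1); [lra |].
  replace (X * (Y / (X + 1)) * (X + 1)) with (X * Y) by (field; lra). nra.
Qed.

(** The threshold [d] is chosen before [lam], [w] and [u]; this uniformity lets the expansion be
    applied along a whole branch as [eta] tends to 0. *)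
Lemma first_mode_expansion (f : R -> R) (B C : R) :
  continuity f ->
  (forall eps, 0 < eps -> exists d, 0 < d /\ forall x, Rabs x < d ->
    Rabs (f x - x - B * x ^ 2 - C * x ^ 3) <= eps * Rabs x ^ 3) ->
  forall eps, 0 < eps -> exists d, 0 < d /\
  forall (lam w : R) (u : R -> R),
    Rabs (lam - 1) <= d -> Rabs (cos w) <= d -> delayed_profile f lam w u ->
    (forall s, Rabs (u s) <= d) -> (exists s, u s <> 0) ->
    pint (fun s => u s * sin s) = 0 ->
    exists A, A <> 0 /\
      Rabs (lam * sin w - 1 - (3 / 4 * C - 11 / 10 * B ^ 2) * A ^ 2) <= eps * A ^ 2 /\
      Rabs (lam * cos w - B ^ 2 / 5 * A ^ 2) <= eps * A ^ 2.
Proof.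
intros Cf Tf eps Heps.
assert (b0 := Rabs_pos B). assert (c0 := Rabs_pos C). assert (HP := PI_RGT_0).
(* The shares [eps / 32] here and [eps / 4] for [M * d] below give
   [2 * (8 * eps1 + d * M) <= eps]. *)
set (eps1 := Rmin 1 (eps / 32)).
assert (E1 : 0 < eps1) by (unfold eps1; apply Rmin_glb_lt; lra).
assert (E1a : eps1 <= 1) by apply Rmin_l.
assert (E1b : eps1 <= eps / 32) by apply Rmin_r.
destruct (Tf eps1 E1) as (d0 & Hd0 & HT).
set (K := 3 * (Rabs B + 1) * (Rabs C + 1 + Rabs B)).
assert (K0 : 0 <= K) by (unfold K; nra).
set (rho := 100 * (6 * K + 10 * Rabs B)).
assert (R0 : 0 <= rho) by (unfold rho; lra).
set (M := Rabs B * (2 * rho + 2 * (Rabs B + 1) ^ 2) + 14 * Rabs C * (Rabs B + 1)).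
assert (M0 : 0 <= M).
{ unfold M. assert (0 <= (Rabs B + 1) ^ 2) by apply pow2_ge_0.
  apply Rplus_le_le_0_compat; apply Rmult_le_pos; lra. }
set (D := Rmin (d0 / 2) (1 / 100)).
assert (HD : 0 < D) by (apply Rmin_glb_lt; lra).
assert (HD1 : D <= d0 / 2) by apply Rmin_l. assert (HD2 : D <= 1 / 100) by apply Rmin_r.
destruct (small_factor D K (1 / 1200) HD K0 ltac:(lra)) as (d1 & Hd1 & X1).
destruct (small_factor d1 rho 1 (proj1 Hd1) R0 ltac:(lra)) as (d2 & Hd2 & X2).
destruct (small_factor d2 (2 * (Rabs B + 1)) 1 (proj1 Hd2) ltac:(lra) ltac:(lra))
  as (d3 & Hd3 & X3).
destruct (small_factor d3 M (eps / 4) (proj1 Hd3) M0 ltac:(lra)) as (d & Hd & X4).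
specialize (X1 d ltac:(lra)). specialize (X2 d ltac:(lra)).
specialize (X3 d ltac:(lra)). specialize (X4 d ltac:(lra)).
exists d. split; [lra |]. intros lam w u Hl Hw Hu Hud [s1 Hs1] Hs.
assert (Cu := profile_continuity _ _ _ _ Hu).
assert (CV := continuity_second_mode B).
assert (Cg : continuity (fun s => f (u s))) by exact (continuity_comp u f Cu Cf).
set (A := pint (fun s => u s * cos s) / PI).
assert (Hc : pint (fun s => u s * cos s) = PI * A) by (unfold A; field; lra).
assert (HA := amplitude_bound u A d Cu Hud Hc).
(* The cubic Taylor term is put into the error, whence the constant [Rabs C + 1]. *)
assert (Hf2 : forall x, Rabs x <= d -> Rabs (f x - x - B * x ^ 2) <= (Rabs C + 1) * Rabs x ^ 3).
{ intros x Hx.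
  replace (f x - x - B * x ^ 2) with ((f x - x - B * x ^ 2 - C * x ^ 3) + C * x ^ 3) by ring.
  eapply Rle_trans; [apply Rabs_triang |].
  rewrite Rmult_plus_distr_r, Rplus_comm, Rabs_mult, <- RPow_abs.
  apply Rplus_le_compat_l. eapply Rle_trans; [apply HT; lra |].
  apply Rmult_le_compat_r; [apply pow_le, Rabs_pos | exact E1a]. }
assert (Hz := remainder_bound f u B (Rabs C + 1) lam w d A Cf ltac:(lra) Hf2
  ltac:(lra) X1 Hl Hw Hu Hud Hs Hc).
fold K in Hz. fold rho in Hz.
(* The remainder bound is proportional to [A^2], so [A = 0] would force [u] to vanish
   identically. *)
assert (A0 : A <> 0).
{ intros A0. apply Hs1. specialize (Hz s1). rewrite A0 in Hz.
  replace (u s1 - 0 * cos s1 - 0 * 0 * second_mode B s1) with (u s1) in Hz by ring.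
  rewrite !Rmult_0_r in Hz.
  destruct (Req_dec (u s1) 0) as [-> | Hn]; [reflexivity |].
  assert (X := Rabs_pos_lt _ Hn). lra. }
apply Rabs_le_between in Hl as Hl'.
destruct (profile_projections f lam w u A Cf ltac:(lra) Hu Hs Hc) as (_ & Pc & Ps).
exists A. split; [exact A0 |].
set (e := fun s => f (u s) - u s - B * (A * A) * (cos s * cos s)
  - 2 * B * (A * A * A) * (second_mode B s * cos s)
  - C * (A * A * A) * (cos s * cos s * cos s)).
assert (Ce : continuity e) by (unfold e; cont).
set (E := (8 * eps1 + d * M) * Rabs A ^ 3).
assert (He : forall s, Rabs (e s) <= E).
{ intros s.
  replace (e s) with (f (u s) - u s - B * (A * cos s * (A * cos s))
    - 2 * B * (A * A) * (A * cos s * second_mode B s)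
    - C * (A * cos s * (A * cos s) * (A * cos s))) by (unfold e; ring).
  apply (cubic_error B C A (A * cos s) (second_mode B s)
     (u s - A * cos s - A * A * second_mode B s) (u s) (f (u s)) d rho eps1); try lra.
  - rewrite Rabs_mult. rewrite <- (Rmult_1_r (Rabs A)) at 2.
    apply Rmult_le_compat_l; [apply Rabs_pos | apply Rabs_cos_le].
  - apply Rabs_second_mode.
  - apply Hz.
  - apply HT. specialize (Hud s). lra. }
assert (Bm : forall c, continuity c -> (forall s, Rabs (c s) <= 1) ->
  Rabs (pint (fun s => e s * c s)) <= 2 * PI * E).
{ intros c Cc Hc1. apply pint_bound; [cont |]. intros s.
  rewrite Rabs_mult, <- (Rmult_1_r E).
  apply Rmult_le_compat; try apply Rabs_pos; [apply He | apply Hc1]. }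
assert (HE : 2 * E <= Rabs A * (eps * A ^ 2)).
{ unfold E. rewrite <- (pow2_abs A).
  replace (Rabs A * (eps * Rabs A ^ 2)) with (eps * Rabs A ^ 3) by ring.
  rewrite <- Rmult_assoc. apply Rmult_le_compat_r; [apply pow_le, Rabs_pos | lra]. }
assert (Fin : forall x, Rabs (PI * (A * x)) <= 2 * PI * E -> Rabs x <= eps * A ^ 2).
{ intros x Hx. rewrite !Rabs_mult, (Rabs_pos_eq PI) in Hx by lra.
  assert (X := Rabs_pos_lt _ A0).
  apply Rmult_le_reg_l with (Rabs A); [exact X |].
  apply Rle_trans with (2 * E); [| exact HE].
  apply Rmult_le_reg_l with PI; lra. }
split; apply Fin.
- replace (PI * (A * (lam * sin w - 1 - (3 / 4 * C - 11 / 10 * B ^ 2) * A ^ 2)))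
    with (pint (fun s => e s * cos s)).
  { apply Bm; [cont | apply Rabs_cos_le]. }
  transitivity (pint (fun s => f (u s) * cos s - u s * cos s
      - B * (A * A) * (cos s * cos s * cos s)
      - 2 * B * (A * A * A) * (second_mode B s * (cos s * cos s))
      - C * (A * A * A) * (cos s * cos s * cos s * cos s))).
  + apply pint_ext; intros s. unfold e. ring.
  + rewrite !pint_sub, !pint_scal, Pc, Hc, pint_cos2_cos, pint_second_mode_cos_cos,
      pint_cos3_cos by cont. field.
- replace (PI * (A * (lam * cos w - B ^ 2 / 5 * A ^ 2)))
    with (pint (fun s => e s * sin s)).
  { apply Bm; [cont | apply Rabs_sin_le]. }
  transitivity (pint (fun s => f (u s) * sin s - u s * sin s
      - B * (A * A) * (cos s * cos s * sin s)
      - 2 * B * (A * A * A) * (second_mode B s * (cos s * sin s))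
      - C * (A * A * A) * (cos s * cos s * cos s * sin s))).
  + apply pint_ext; intros s. unfold e. ring.
  + rewrite !pint_sub, !pint_scal, Ps, Hs, pint_cos2_sin, pint_second_mode_cos_sin,
      pint_cos3_sin by cont. field.
Qed.

(** * Choice of the phase *)

(** Translation rotates the pair of first Fourier coefficients. The angle whose tangent is the ratio
    of sine to cosine coefficient works, and a quarter turn works when the cosine coefficient is
    0. *)
Lemma exists_phase (u : R -> R) : continuity u -> (forall s, u (s + 2 * PI) = u s) ->
  exists th, pint (fun s => u (s + th) * sin s) = 0.
Proof.
intros Cu Hp.
assert (X : forall th, pint (fun s => u (s + th) * sin s) =
  cos th * pint (fun s => u s * sin s) - sin th * pint (fun s => u s * cos s)).
{ intros th. rewrite <- !pint_scal, <- pint_sub by cont.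
  rewrite <- (pint_translate (fun s => cos th * (u s * sin s) - sin th * (u s * cos s)) th).
  - apply pint_ext; intros s. cbv beta. replace s with (s + th - th) at 2 by ring.
    rewrite sin_minus. ring.
  - cont.
  - intros s. rewrite Hp, sin_plus, cos_plus, sin_2PI, cos_2PI. ring. }
destruct (Req_dec (pint (fun s => u s * cos s)) 0) as [E | E].
- exists (PI / 2). rewrite X, E, cos_PI2. ring.
- exists (atan (pint (fun s => u s * sin s) / pint (fun s => u s * cos s))).
  rewrite X. set (a := pint (fun s => u s * sin s)) in *.
  set (b := pint (fun s => u s * cos s)) in *.
  assert (Ht := tan_atan (a / b)). unfold tan in Ht.
  assert (Hb := atan_bound (a / b)).
  assert (Hc : 0 < cos (atan (a / b))) by (apply cos_gt_0; lra).
  assert (Hs : sin (atan (a / b)) = a / b * cos (atan (a / b))).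
  { rewrite <- Ht at 2. field. lra. }
  rewrite Hs. field. exact E.
Qed.

(** * First-order solution of the frequency equations *)

Lemma sin_sub_id (x : R) : Rabs x <= 1 -> Rabs (x - sin x) <= Rabs x * (x * x) / 6.
Proof.
assert (P : forall y, 0 <= y <= 1 -> Rabs (y - sin y) <= y * (y * y) / 6).
{ intros y Hy. destruct (pre_sin_bound y 0) as [Hl _]; try lra.
  unfold sin_approx, sin_term in Hl. simpl in Hl.
  assert (Hu := sin_le_id y (proj1 Hy)). apply Rabs_le. lra. }
intros Hx. destruct (Rle_or_lt 0 x) as [H | H].
- rewrite (Rabs_pos_eq x) in * by lra. apply P; lra.
- rewrite (Rabs_left x) in * by lra.
  replace (x - sin x) with (- (- x - sin (- x))) by (rewrite sin_neg; ring).
  rewrite Rabs_Ropp. replace (x * x) with (- x * - x) by ring. apply P; lra.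
Qed.

Lemma one_sub_cos (x : R) : Rabs x <= 1 -> Rabs (1 - cos x) <= x * x / 2.
Proof.
intros Hx. apply Rabs_le_between in Hx.
destruct (pre_cos_bound x 0) as [Hl _]; try lra.
unfold cos_approx, cos_term in Hl. simpl in Hl.
assert (Hu := COS_bound x). apply Rabs_le. nra.
Qed.

(* [T - (2 PI + eta / j) / mu] is a positive multiple of the expression estimated here
   when [X = 2 PI j], [T = 2 PI / w], [lam = w / mu], [eta = w0 - mu]. *)
Lemma period_defect_expansion (P Q w0 X : R) :
  sin w0 = 1 -> cos w0 = 0 -> forall zeta, 0 < zeta ->
  exists eps d, 0 < eps /\ 0 < d /\ forall lam w A eps',
    0 <= eps' <= eps -> Rabs (lam - 1) <= d -> Rabs (w - w0) <= d ->
    Rabs (lam * sin w - 1 - P * A ^ 2) <= eps' * A ^ 2 ->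
    Rabs (lam * cos w - Q * A ^ 2) <= eps' * A ^ 2 ->
    Rabs ((1 - lam) * (X + w) + lam * (w - w0) - (- P * (X + w0) - Q) * A ^ 2)
      <= zeta * A ^ 2.
Proof.
intros S0 C0 zeta Hz.
set (N := Rabs (X + w0)). assert (N0 : 0 <= N) by apply Rabs_pos.
(* [S * A^2] will bound [|w - w0|]: one factor 2 comes from [lam >= 1 / 2], the other from comparing
   [sg] with [sin sg]. *)
set (S := 4 * (Rabs Q + 1)). assert (HS : 0 < S) by (assert (X0 := Rabs_pos Q); unfold S; lra).
destruct (small_factor 1 (N + 1) (zeta / 2) ltac:(lra) ltac:(lra) ltac:(lra)) as (eps & He & Xe).
destruct (small_factor (1 / 2) (2 * N * S + 3 * S) (zeta / 2) ltac:(lra)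
  ltac:(assert (0 <= N * S) by (apply Rmult_le_pos; lra); lra) ltac:(lra)) as (d & Hd & Xd).
exists eps, d. split; [lra | split; [lra |]].
intros lam w A eps' He' Hl Hw H1 H2.
specialize (Xe eps' ltac:(lra)). specialize (Xd d ltac:(lra)).
set (sg := w - w0) in *.
assert (Es : sin w = cos sg).
{ replace w with (sg + w0) by (unfold sg; ring). rewrite sin_plus, S0, C0. ring. }
assert (Ec : cos w = - sin sg).
{ replace w with (sg + w0) by (unfold sg; ring). rewrite cos_plus, S0, C0. ring. }
rewrite Es in H1. rewrite Ec in H2.
assert (a0 : 0 <= A ^ 2) by apply pow2_ge_0. set (a := A ^ 2) in *.
assert (Hl' := Hl). apply Rabs_le_between in Hl'.
assert (D1 := sin_sub_id sg ltac:(lra)). assert (D2 := one_sub_cos sg ltac:(lra)).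
assert (g0 := Rabs_pos sg).
assert (sq : sg * sg = Rabs sg * Rabs sg)
  by (rewrite <- Rabs_mult, Rabs_pos_eq; [reflexivity | nra]).
rewrite sq in D1, D2. set (g := Rabs sg) in *.
assert (dg0 : 0 <= d * g) by (apply Rmult_le_pos; lra).
assert (gg : g * g <= d * g) by (apply Rmult_le_compat_r; lra).
assert (D1a : Rabs (sg - sin sg) <= d * g).
{ eapply Rle_trans; [exact D1 |].
  assert (g2 : 0 <= g * g) by (apply Rmult_le_pos; exact g0).
  assert (g * (g * g) <= 1 * (g * g)) by (apply Rmult_le_compat_r; lra). lra. }
assert (Hsin : g <= 2 * Rabs (sin sg)).
{ assert (g <= Rabs (sg - sin sg) + Rabs (sin sg)).
  { unfold g. replace sg with ((sg - sin sg) + sin sg) at 1 by ring. apply Rabs_triang. }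
  assert (d * g <= 1 / 2 * g) by (apply Rmult_le_compat_r; lra). lra. }
assert (HQ : lam * Rabs (sin sg) <= (Rabs Q + 1) * a).
{ rewrite <- (Rabs_pos_eq lam) by lra. rewrite <- Rabs_mult.
  replace (lam * sin sg) with (- (lam * - sin sg - Q * a) + - (Q * a)) by ring.
  eapply Rle_trans; [apply Rabs_triang |]. rewrite !Rabs_Ropp.
  rewrite (Rabs_mult Q a), (Rabs_pos_eq a) by lra.
  assert (eps' * a <= 1 * a) by (apply Rmult_le_compat_r; lra). lra. }
assert (Hg : g <= S * a).
{ unfold S. assert (1 / 2 * Rabs (sin sg) <= lam * Rabs (sin sg))
    by (apply Rmult_le_compat_r; [apply Rabs_pos | lra]). lra. }
assert (dg : d * g <= d * S * a) by (rewrite Rmult_assoc; apply Rmult_le_compat_l; lra).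
assert (G1 : Rabs (lam - 1 - P * a) <= (eps' + 2 * d * S) * a).
{ replace (lam - 1 - P * a) with ((lam * cos sg - 1 - P * a) + lam * (1 - cos sg)) by ring.
  eapply Rle_trans; [apply Rabs_triang |].
  rewrite (Rabs_mult lam), (Rabs_pos_eq lam) by lra.
  assert (lam * Rabs (1 - cos sg) <= 2 * (d * g)).
  { apply Rmult_le_compat; [lra | apply Rabs_pos | lra | lra]. }
  lra. }
assert (G2 : Rabs (lam * sg + Q * a) <= (eps' + 2 * d * S) * a).
{ replace (lam * sg + Q * a) with (- (lam * - sin sg - Q * a) + lam * (sg - sin sg)) by ring.
  eapply Rle_trans; [apply Rabs_triang |].
  rewrite Rabs_Ropp, (Rabs_mult lam), (Rabs_pos_eq lam) by lra.
  assert (lam * Rabs (sg - sin sg) <= 2 * (d * g)).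
  { apply Rmult_le_compat; [lra | apply Rabs_pos | lra | lra]. }
  lra. }
assert (G3 : Rabs ((1 - lam) * sg) <= d * S * a).
{ rewrite Rabs_mult, Rabs_minus_sym. fold g. eapply Rle_trans; [| exact dg].
  apply Rmult_le_compat_r; assumption. }
(* To first order [lam - 1 = P a] and [lam * sg = - Q a]; the product [(1 - lam) * sg] is of higher
   order. *)
replace ((1 - lam) * (X + w) + lam * sg - (- P * (X + w0) - Q) * a)
  with (- ((lam - 1 - P * a) * (X + w0)) + (1 - lam) * sg + (lam * sg + Q * a))
  by (unfold sg; ring).
eapply Rle_trans; [apply Rabs_triang |].
apply Rle_trans with ((eps' + 2 * d * S) * a * N + d * S * a + (eps' + 2 * d * S) * a).
- apply Rplus_le_compat; [| exact G2].
  eapply Rle_trans; [apply Rabs_triang |]. apply Rplus_le_compat; [| exact G3].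
  rewrite Rabs_Ropp, Rabs_mult. apply Rmult_le_compat_r; [exact N0 | exact G1].
- replace ((eps' + 2 * d * S) * a * N + d * S * a + (eps' + 2 * d * S) * a)
    with (((N + 1) * eps' + (2 * N * S + 3 * S) * d) * a) by ring.
  apply Rmult_le_compat_r; lra.
Qed.

(** * Criticality thresholds and the period bounds *)

Lemma mu_k_trig (k : nat) : sin (mu_k k) = 1 /\ cos (mu_k k) = 0.
Proof.
unfold mu_k. replace ((4 * INR k + 1) * PI / 2) with (PI / 2 + 2 * INR k * PI) by field.
rewrite sin_period, cos_period, sin_PI2, cos_PI2. split; reflexivity.
Qed.

(** Since [Hk k = 22 / 15 - 4 / (15 * mu_k k)], multiplication by [mu_k k] makes the threshold
    condition affine in [mu_k k]; the negative factor reverses the inequality. *)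
Lemma Hk_scaled (k : nat) (B C : R) :
  C - Hk k * B ^ 2 =
  - (40 / (30 * mu_k k)) * ((11 / 10 * B ^ 2 - 3 / 4 * C) * mu_k k - B ^ 2 / 5).
Proof.
assert (HP := PI_RGT_0). assert (Hk0 := pos_INR k).
unfold Hk, mu_k. field. split; lra.
Qed.

Lemma mu_k_pos (k : nat) : 3 / 2 < mu_k k.
Proof.
assert (HP := PI2_3_2). assert (Hk0 := pos_INR k). unfold mu_k. nra.
Qed.

Lemma Hk_gt (k : nat) (B C : R) : C > Hk k * B ^ 2 <->
  (11 / 10 * B ^ 2 - 3 / 4 * C) * mu_k k < B ^ 2 / 5.
Proof.
assert (E := Hk_scaled k B C). assert (M := mu_k_pos k).
set (Y := (11 / 10 * B ^ 2 - 3 / 4 * C) * mu_k k - B ^ 2 / 5) in *.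
assert (F : 0 < 40 / (30 * mu_k k)) by (apply Rdiv_lt_0_compat; lra).
split; intros H.
- assert (Y < 0); [| unfold Y in *; lra]. destruct (Rlt_or_le Y 0) as [h | h]; [exact h | nra].
- assert (Y < 0) by (unfold Y; lra). nra.
Qed.

Lemma Hk_lt (k : nat) (B C : R) : C < Hk k * B ^ 2 <->
  B ^ 2 / 5 < (11 / 10 * B ^ 2 - 3 / 4 * C) * mu_k k.
Proof.
assert (E := Hk_scaled k B C). assert (M := mu_k_pos k).
set (Y := (11 / 10 * B ^ 2 - 3 / 4 * C) * mu_k k - B ^ 2 / 5) in *.
assert (F : 0 < 40 / (30 * mu_k k)) by (apply Rdiv_lt_0_compat; lra).
split; intros H.
- assert (0 < Y); [| unfold Y in *; lra]. destruct (Rlt_or_le 0 Y) as [h | h]; [exact h | nra].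
- assert (0 < Y) by (unfold Y; lra). nra.
Qed.

(** This shift ties the period bound with parameter [j] on branch [k] to the criticality threshold
    of index [k + j]. *)
Lemma mu_k_add (k j : nat) : 2 * PI * INR j + mu_k k = mu_k (k + j).
Proof. unfold mu_k. rewrite plus_INR. field. Qed.

(** Multiplying numerator and denominator of the bound by [PI / 2] turns it into
    [(2 * PI + eta / INR j) / mu]; substituting [eta = mu_k k - mu] then gives the right-hand
    side. *)
Lemma period_bound_defect (k j : nat) (eta w : R) :
  (0 < j)%nat -> 0 < w -> eta < mu_k k ->
  let mu := mu_k k - eta in let lam := w / mu in
  2 * PI / w - (4 + 2 * eta / (INR j * PI)) / (4 * INR k + 1 - 2 * eta / PI) =
  ((1 - lam) * (2 * PI * INR j + w) + lam * (w - mu_k k)) / (INR j * w).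
Proof.
intros Hj Hw He mu lam. assert (HP := PI_RGT_0).
assert (Hj0 : 0 < INR j) by (apply lt_0_INR; exact Hj).
assert (Hmu : 0 < mu) by (unfold mu; lra).
replace ((4 + 2 * eta / (INR j * PI)) / (4 * INR k + 1 - 2 * eta / PI))
  with ((2 * PI + eta / INR j) / mu).
- assert (Ee : eta = mu_k k - mu) by (unfold mu; ring).
  unfold lam. clearbody mu. rewrite Ee. field. lra.
- unfold mu, mu_k in *. field. repeat split; lra.
Qed.

(** * From the Hopf branch to rescaled profiles *)

Definition rescaled_profile (x : R -> R) (w th : R) : R -> R := fun s => x ((s + th) / w).

Lemma rescaled_profile_eq (f x : R -> R) (mu w th T : R) :
  0 < w -> 0 < mu -> T = 2 * PI / w -> is_solution mu f x -> (forall t, x (t + T) = x t) ->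
  delayed_profile f (w / mu) w (rescaled_profile x w th).
Proof.
intros Hw Hmu HT Hx Hp. unfold rescaled_profile. split.
- intros s. assert (X := Hx ((s + w + th) / w)). apply is_derive_Reals in X.
  evar_last.
  + apply (is_derive_comp x (fun s => (s + th) / w)); [exact X |].
    auto_derive; [lra | reflexivity].
  + replace ((s + w + th) / w - 1) with ((s + th) / w) by (field; lra).
    change scal with Rmult. cbv beta. eqR. cbn. field. lra.
- intros s. rewrite <- (Hp ((s + th) / w)). f_equal. rewrite HT. field. lra.
Qed.

(** The first entry of the minimum keeps [T > T0 / 2], which bounds [2 * PI / (T * T0)] by
    [4 * PI / (T0 * T0)]; the second entry is [r] divided by that constant. *)
Lemma frequency_close (T T0 w0 r : R) :
  0 < T0 -> w0 = 2 * PI / T0 -> 0 < r ->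
  Rabs (T - T0) < Rmin (T0 / 2) (r * (T0 * T0) / (4 * PI)) ->
  0 < T /\ Rabs (2 * PI / T - w0) <= r.
Proof.
intros HT0 -> Hr H. assert (HP := PI_RGT_0).
assert (H1 := Rlt_le_trans _ _ _ H (Rmin_l _ _)).
assert (H2 := Rlt_le_trans _ _ _ H (Rmin_r _ _)).
assert (H1' := H1). apply Rabs_lt_between in H1'.
assert (HT : 0 < T) by lra. split; [exact HT |].
replace (2 * PI / T - 2 * PI / T0) with ((T - T0) * (- (2 * PI / (T * T0)))) by (field; lra).
rewrite Rabs_mult, Rabs_Ropp.
assert (TT : 0 < T * T0) by (apply Rmult_lt_0_compat; lra).
rewrite (Rabs_pos_eq (2 * PI / (T * T0))) by (apply Rlt_le, Rdiv_lt_0_compat; lra).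
apply Rle_trans with (r * (T0 * T0) / (4 * PI) * (2 * PI / (T * T0))).
- apply Rmult_le_compat_r; [apply Rlt_le, Rdiv_lt_0_compat; lra | lra].
- replace (r * (T0 * T0) / (4 * PI) * (2 * PI / (T * T0)))
    with (r * (T0 / (2 * T))) by (field; lra).
  rewrite <- (Rmult_1_r r) at 2. apply Rmult_le_compat_l; [lra |].
  apply Rmult_le_reg_r with (2 * T); [lra |].
  replace (T0 / (2 * T) * (2 * T)) with T0 by (field; lra). lra.
Qed.

(** Convergence of the period brings [w] near [mu_k k], hence [lam] near 1 and [cos w] near 0; decay
    of the amplitude makes the profile small. Thus [first_mode_expansion] applies for small
    [eta]. *)
Lemma hopf_branch_expansion (f f1 f2 f3 : R -> R) (B C : R) (k : nat)
    (etak : R) (p : R -> R -> R) (T : R -> R) :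
  is_C3 f f1 f2 f3 -> f 0 = 0 -> f1 0 = 1 -> B = f2 0 / 2 -> C = f3 0 / 6 ->
  C > Hk k * B ^ 2 -> hopf_branch f B C k etak p T ->
  forall eps d, 0 < eps -> 0 < d -> exists eta0, 0 < eta0 < mu_k k /\
  forall eta, 0 < eta < eta0 -> eta < etak ->
    exists A w, A <> 0 /\ 0 < w /\ T eta = 2 * PI / w /\ Rabs (w - mu_k k) <= d /\
      let lam := w / (mu_k k - eta) in
      Rabs (lam - 1) <= d /\
      Rabs (lam * sin w - 1 - (3 / 4 * C - 11 / 10 * B ^ 2) * A ^ 2) <= eps * A ^ 2 /\
      Rabs (lam * cos w - B ^ 2 / 5 * A ^ 2) <= eps * A ^ 2.
Proof.
intros Hf f0 f10 HB HC Hsub (Hek & Hsol & Hamp & Hper) eps d Heps Hd.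
assert (HP := PI_RGT_0). assert (Hk0 := pos_INR k). assert (Hm := mu_k_pos k).
assert (Cf : continuity f).
{ apply (continuity_derive f f1). intros s. apply is_derive_Reals. apply (proj1 Hf). }
destruct (first_mode_expansion f B C Cf (taylor3 _ _ _ _ B C Hf f0 f10 HB HC) eps Heps)
  as (d1 & Hd1 & HE).
set (r := Rmin d d1 / 4).
assert (Hr : 0 < r) by (unfold r; assert (0 < Rmin d d1) by (apply Rmin_glb_lt; lra); lra).
assert (Hrd : 4 * r <= d) by (unfold r; assert (X := Rmin_l d d1); lra).
assert (Hrd1 : 4 * r <= d1) by (unfold r; assert (X := Rmin_r d d1); lra).
set (T0 := 4 / (4 * INR k + 1)).
assert (HT0 : 0 < T0) by (apply Rdiv_lt_0_compat; lra).
assert (Hw0 : mu_k k = 2 * PI / T0) by (unfold mu_k, T0; field; lra).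
destruct (Hamp d1 Hd1) as (e1 & He1 & Ha).
destruct (Hper (Rmin (T0 / 2) (r * (T0 * T0) / (4 * PI)))) as (e2 & He2 & Hp).
{ apply Rmin_glb_lt; [lra |]. apply Rdiv_lt_0_compat; [| lra].
  apply Rmult_lt_0_compat; [exact Hr | apply Rmult_lt_0_compat; exact HT0]. }
set (eta0 := Rmin (Rmin e1 e2) (Rmin r (1 / 2))).
exists eta0. split.
{ split; [unfold eta0; repeat apply Rmin_glb_lt; lra |].
  apply Rle_lt_trans with (1 / 2); [| lra].
  eapply Rle_trans; [apply Rmin_r | apply Rmin_r]. }
intros eta He Hek'.
assert (L1 : eta < e1) by (eapply Rlt_le_trans; [apply He |]; eapply Rle_trans; apply Rmin_l).
assert (L2 : eta < e2)
  by (eapply Rlt_le_trans; [apply He |]; eapply Rle_trans; [apply Rmin_l | apply Rmin_r]).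
assert (L3 : eta < r)
  by (eapply Rlt_le_trans; [apply He |]; eapply Rle_trans; [apply Rmin_r | apply Rmin_l]).
assert (L4 : eta < 1 / 2)
  by (eapply Rlt_le_trans; [apply He |]; eapply Rle_trans; [apply Rmin_r | apply Rmin_r]).
assert (Hrange : 0 < eta < etak) by lra.
destruct (Hsol eta Hrange) as (Hs & Hn & HTp & HTper & _).
specialize (Ha eta Hrange L1). specialize (Hp eta Hrange L2).
destruct (frequency_close (T eta) T0 (mu_k k) r HT0 Hw0 Hr Hp) as [_ Hw].
set (w := 2 * PI / T eta) in *.
assert (w0 : 0 < w) by (apply Rdiv_lt_0_compat; lra).
assert (HTw : T eta = 2 * PI / w) by (unfold w; field; lra).
(* Subcriticality makes the branch direction [-1]. *)
assert (Hmu : mu_k k + delta_k B C k * eta = mu_k k - eta).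
{ unfold delta_k. destruct (Rlt_dec C (Hk k * B ^ 2)); lra. }
rewrite Hmu in Hs. set (mu := mu_k k - eta) in *.
assert (Hmu1 : 1 <= mu) by (unfold mu; lra).
assert (Hlam : Rabs (w / mu - 1) <= 2 * r).
{ replace (w / mu - 1) with ((w - mu) * / mu) by (field; lra).
  rewrite Rabs_mult, <- (Rmult_1_r (2 * r)).
  apply Rmult_le_compat; try apply Rabs_pos.
  - apply Rabs_le_between in Hw. apply Rabs_le. unfold mu. lra.
  - rewrite Rabs_pos_eq by (apply Rlt_le, Rinv_0_lt_compat; lra).
    rewrite <- Rinv_1. apply Rinv_le_contravar; lra. }
destruct (mu_k_trig k) as [S0 C0].
(* Around [mu_k k] the cosine is minus the sine of the deviation, hence bounded by it. *)
assert (Hcos : Rabs (cos w) <= r).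
{ eapply Rle_trans; [| exact Hw]. replace w with ((w - mu_k k) + mu_k k) at 1 by ring.
  rewrite cos_plus, S0, C0. rewrite Rmult_0_r, Rmult_1_r, Rminus_0_l, Rabs_Ropp.
  set (y := w - mu_k k). destruct (Rle_or_lt 0 y) as [hy | hy].
  - rewrite (Rabs_pos_eq y) by exact hy. destruct (Rle_or_lt y 1) as [h1 | h1].
    + assert (X := sin_le_id y hy).
      assert (0 <= sin y) by (apply sin_ge_0; assert (Y := PI2_3_2); lra).
      rewrite Rabs_pos_eq; assumption.
    + assert (X := Rabs_sin_le y). lra.
  - rewrite (Rabs_left y) by exact hy. destruct (Rle_or_lt (- y) 1) as [h1 | h1].
    + assert (X := sin_le_id (- y) ltac:(lra)).
      assert (0 <= sin (- y)) by (apply sin_ge_0; assert (Y := PI2_3_2); lra).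
      rewrite <- Rabs_Ropp, <- sin_neg, Rabs_pos_eq; assumption.
    + assert (X := Rabs_sin_le y). lra. }
assert (Prof : forall th, delayed_profile f (w / mu) w (rescaled_profile (p eta) w th)).
{ intros th. apply (rescaled_profile_eq f (p eta) mu w th (T eta)); try assumption. lra. }
destruct (exists_phase (rescaled_profile (p eta) w 0)) as [th Hth].
{ exact (profile_continuity _ _ _ _ (Prof 0)). }
{ apply (Prof 0). }
assert (Hth' : pint (fun s => rescaled_profile (p eta) w th s * sin s) = 0).
{ rewrite <- Hth. apply pint_ext; intros s. unfold rescaled_profile. do 3 f_equal. ring. }
destruct (HE (w / mu) w (rescaled_profile (p eta) w th)) as (A & A0 & E1 & E2);
  [lra | lra | apply Prof | | | exact Hth' |].
- intros s. apply Rlt_le, Ha.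
- assert (NZ : exists t, p eta t <> 0).
  { destruct Hn as (t1 & t2 & Ht). destruct (Req_dec (p eta t1) 0) as [z1 | z1].
    - exists t2. lra.
    - exists t1. exact z1. }
  destruct NZ as [t Ht]. exists (w * t - th). unfold rescaled_profile.
  replace ((w * t - th + th) / w) with t by (field; lra). exact Ht.
- exists A, w. split; [exact A0 |]. split; [exact w0 |]. split; [exact HTw |].
  split; [lra |]. cbv zeta. split; [lra |]. split; assumption.
Qed.

(* The coefficient of [A ^ 2] in [period_defect_expansion] for [X = 2 PI j] and [m = k + j]. *)
Definition defect_limit (B C : R) (m : nat) : R :=
  - (3 / 4 * C - 11 / 10 * B ^ 2) * mu_k m - B ^ 2 / 5.

(** With tolerance [Rabs L / 2] in [period_defect_expansion], the defect keeps the sign of its limit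
    coefficient [L]; a positive product covers both signs of [L] at once. *)
Lemma period_versus_bound (f f1 f2 f3 : R -> R) (B C : R) (k j : nat)
    (etak : R) (p : R -> R -> R) (T : R -> R) :
  is_C3 f f1 f2 f3 -> f 0 = 0 -> f1 0 = 1 -> B = f2 0 / 2 -> C = f3 0 / 6 ->
  C > Hk k * B ^ 2 -> hopf_branch f B C k etak p T -> (0 < j)%nat ->
  defect_limit B C (k + j) <> 0 ->
  exists eta0, 0 < eta0 /\ forall eta, 0 < eta < eta0 -> eta < etak ->
    0 < (T eta - (4 + 2 * eta / (INR j * PI)) / (4 * INR k + 1 - 2 * eta / PI))
        * defect_limit B C (k + j).
Proof.
intros Hf f0 f10 HB HC Hsub Hbr Hj HL. set (L := defect_limit B C (k + j)) in *.
assert (HP := PI_RGT_0).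
destruct (mu_k_trig k) as [S0 C0].
assert (HLa := Rabs_pos_lt L HL).
destruct (period_defect_expansion (3 / 4 * C - 11 / 10 * B ^ 2) (B ^ 2 / 5) (mu_k k)
  (2 * PI * INR j) S0 C0 (Rabs L / 2) ltac:(lra)) as (eps & d & He & Hd & HD).
destruct (hopf_branch_expansion f f1 f2 f3 B C k etak p T Hf f0 f10 HB HC Hsub Hbr eps d He Hd)
  as (eta0 & Heta0 & HE).
exists eta0. split; [apply Heta0 |]. intros eta Heta Hek.
destruct (HE eta Heta Hek) as (A & w & A0 & w0 & HT & Hw & Hl & E1 & E2).
rewrite HT, period_bound_defect by (try assumption; lra). cbv zeta.
specialize (HD _ w A eps ltac:(lra) Hl Hw E1 E2).
rewrite mu_k_add in HD.
change (- (3 / 4 * C - 11 / 10 * B ^ 2) * mu_k (k + j) - B ^ 2 / 5) with L in HD.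
set (D := (1 - w / (mu_k k - eta)) * (2 * PI * INR j + w)
          + w / (mu_k k - eta) * (w - mu_k k)) in *.
assert (Ha : 0 < A ^ 2) by (apply pow2_gt_0; exact A0).
assert (Hj0 : 0 < INR j * w) by (apply Rmult_lt_0_compat; [apply lt_0_INR; exact Hj | exact w0]).
replace (D / (INR j * w) * L) with (D * L * / (INR j * w)) by (unfold Rdiv; ring).
apply Rmult_lt_0_compat; [| apply Rinv_0_lt_compat; exact Hj0].
apply Rabs_le_between in HD.
assert (X : 0 < Rabs L * A ^ 2) by (apply Rmult_lt_0_compat; assumption).
unfold Rabs in *. destruct (Rcase_abs L) as [l | l].
- assert (D < 0) by nra. nra.
- assert (0 < D) by nra. nra.
Qed.

Theorem theorem4 (f f1 f2 f3 : R -> R) (B C : R) (n k : nat) :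
  is_C3 f f1 f2 f3 -> f 0 = 0 -> f1 0 = 1 ->
  B = f2 0 / 2 -> C = f3 0 / 6 ->
  (22 * PI - 8) / (15 * PI) * B ^ 2 < C -> C < 22 / 15 * B ^ 2 ->
  (forall m : nat, C <> Hk m * B ^ 2) ->
  (* n = max { m >= 0 : C > H(m) B^2 } *)
  C > Hk n * B ^ 2 -> (forall m : nat, C > Hk m * B ^ 2 -> (m <= n)%nat) ->
  (k <= n)%nat ->
  C > Hk k * B ^ 2 /\
  (forall (etak : R) (p : R -> R -> R) (T : R -> R),
     hopf_branch f B C k etak p T ->
     exists eta0, 0 < eta0 /\
       forall eta, 0 < eta < eta0 -> eta < etak ->
         ((k < n)%nat ->
            (4 + 2 * eta / (INR (n - k + 1) * PI)) / (4 * INR k + 1 - 2 * eta / PI)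
              < T eta /\
            T eta <
              (4 + 2 * eta / (INR (n - k) * PI)) / (4 * INR k + 1 - 2 * eta / PI)) /\
         (k = n ->
            T eta > (4 + 2 * eta / PI) / (4 * INR k + 1 - 2 * eta / PI))).
Proof.
intros Hf f0 f10 HB HC _ Hup Hnd Hn Hmax Hkn.
assert (Hsub : C > Hk k * B ^ 2).
(* [C < 22 / 15 * B ^ 2] makes the slope [11 / 10 * B ^ 2 - 3 / 4 * C] positive, and [mu_k]
   increases, so the condition at [n] passes down to [k]. *)
{ apply Hk_gt. apply Hk_gt in Hn. eapply Rle_lt_trans; [| exact Hn].
  apply Rmult_le_compat_l; [lra |].
  unfold mu_k. assert (INR k <= INR n) by now apply le_INR.
  assert (HP := PI_RGT_0). nra. }
split; [exact Hsub |]. intros etak p T Hbr.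
(* Maximality of [n] and nondegeneracy make the condition fail strictly at
   [n + 1 = k + (n - k + 1)], which yields the lower bound. *)
assert (L1 : 0 < defect_limit B C (k + (n - k + 1))).
{ replace (k + (n - k + 1))%nat with (S n) by lia.
  assert (X : C < Hk (S n) * B ^ 2).
  { destruct (Rtotal_order C (Hk (S n) * B ^ 2)) as [h | [h | h]].
    - exact h.
    - exfalso. exact (Hnd _ h).
    - exfalso. assert (Y := Hmax (S n) h). lia. }
  apply Hk_lt in X. unfold defect_limit. lra. }
destruct (period_versus_bound f f1 f2 f3 B C k (n - k + 1) etak p T Hf f0 f10 HB HC Hsub Hbr
  ltac:(lia) ltac:(lra)) as (e1 & He1 & Hlow).
assert (Hlow' : forall eta, 0 < eta < e1 -> eta < etak ->
  (4 + 2 * eta / (INR (n - k + 1) * PI)) / (4 * INR k + 1 - 2 * eta / PI) < T eta).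
{ intros eta He Hek. specialize (Hlow eta He Hek). nra. }
destruct (Nat.eq_dec k n) as [E | NE].
- exists e1. split; [exact He1 |]. intros eta He Hek. split; [lia |]. intros _.
  (* For [k = n] the parameter [n - k + 1] is 1, and its factor disappears from the bound. *)
  specialize (Hlow' eta He Hek). subst k. rewrite Nat.sub_diag in Hlow'.
  simpl INR in Hlow' at 1. rewrite Rmult_1_l in Hlow'. exact Hlow'.
(* The condition holds at [n = k + (n - k)], which gives the upper bound; here [n - k] is
   positive. *)
- assert (L2 : defect_limit B C (k + (n - k)) < 0).
  { replace (k + (n - k))%nat with n by lia. apply Hk_gt in Hn. unfold defect_limit. lra. }
  destruct (period_versus_bound f f1 f2 f3 B C k (n - k) etak p T Hf f0 f10 HB HC Hsub Hbr
    ltac:(lia) ltac:(lra)) as (e2 & He2 & Hhigh).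
  exists (Rmin e1 e2). split; [now apply Rmin_glb_lt |]. intros eta He Hek.
  assert (X1 := Rmin_l e1 e2). assert (X2 := Rmin_r e1 e2).
  split; [intros _; split | lia].
  + apply Hlow'; [lra | exact Hek].
  + specialize (Hhigh eta ltac:(lra) Hek). nra.
Qed.
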